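(* Let $\Omega$ be a compact metric space and $\varphi:\Omega\to\Omega$ a continuous map such that $(\Omega,\varphi)$ is tame. Then $(\Omega,\varphi)$ is ergodically decomposable.
   Context: $X=C(\Omega)$, $X^*$ the space of Radon measures, pairing $(x,\mu)$; $Ux=x\circ\varphi$, $V=U^*$. $\mathrm{W^*O}$-topology on $\mathcal{L}(X^* )$: $T_n\to T$ iff $(x,T_n\mu)\to(x,T\mu)$ for all $x\in X,\mu\in X^*$. A sequence $\{V_n\}\subseteq\operatorname{co}\{V^k:k\in\mathbb{N}_0\}$ is ergodic if $(x,(\operatorname{Id}-V)V_n\mu)\to0$ for all $x,\mu$. $(\Omega,\varphi)$ is ergodically decomposable if there exists an ergodic operator sequence $\{V_n\}$ converging in the $\mathrm{W^*O}$-topology to some $Q$ such that $Q\delta_\omega$ (the weak-star limit of $V_n\delta_\omega$, $\delta_\omega$ the Dirac measure) is a $\varphi$-ergodic Borel probability measure for every $\omega\in\Omega$. $(\Omega,\varphi)$ is tame if for every $x\in X$ and every strictly increasing sequence $\{n(k)\}\subseteq\mathbb{N}_0$, $\inf_a\|\sum_k a_k\,x\circ\varphi^{n(k)}\|_X=0$, the infimum over finitely supported scalar sequences with $\sum_k|a_k|=1$. *)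

(* Defs.v *)
From HB Require Import structures.
From mathcomp Require Import all_boot all_order all_algebra.
From mathcomp Require Import all_classical all_reals all_analysis.
Set Implicit Arguments. Unset Strict Implicit. Unset Printing Implicit Defensive.
Import Order.TTheory GRing.Theory Num.Theory.
Import numFieldNormedType.Exports.
Local Open Scope classical_set_scope.
Local Open Scope ring_scope.

Section Defs.
Variables (R : realType) (T : pseudoPMetricType R).

(* X = C(Omega): continuous functions T -> R with the sup norm.
   X^* : bounded linear functionals on C(Omega) (= Radon measures by Riesz);
   the pairing (x, mu) is  mu x.  Only values on continuous x matter. *)
Definition is_dual (mu : (T -> R) -> R) : Prop :=
  (forall (a : R) (x y : T -> R), continuous x -> continuous y ->
      mu (fun w => a * x w + y w) = a * mu x + mu y) /\
  (exists M : R, forall (x : T -> R) (b : R), continuous x ->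
      (forall w, `|x w| <= b) -> `|mu x| <= M * b).

Definition dirac_fun (w0 : T) : (T -> R) -> R := fun x => x w0.

(* A sequence V_n in co{V^k : k in N_0} (V = U^*, U x = x o phi), encoded by
   finitely supported convex weights: V_n = \sum_(k < N n) c n k V^k. *)
Definition convex_weights (c : nat -> nat -> R) (N : nat -> nat) : Prop :=
  forall n, (forall k, 0 <= c n k) /\ \sum_(k < N n) c n k = 1.

(* pairing (x, V_n mu) = \sum_k c n k (U^k x, mu) *)
Definition Vn_pair (phi : T -> T) (c : nat -> nat -> R) (N : nat -> nat)
  (n : nat) (x : T -> R) (mu : (T -> R) -> R) : R :=
  \sum_(k < N n) c n k * mu (fun w => x (iter k phi w)).

(* ergodic: (x, (Id - V) V_n mu) -> 0 for all x in X, mu in X^* *)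
Definition ergodic_seq (phi : T -> T) (c : nat -> nat -> R) (N : nat -> nat) : Prop :=
  forall (x : T -> R) (mu : (T -> R) -> R), continuous x -> is_dual mu ->
    (fun n => Vn_pair phi c N n x mu - Vn_pair phi c N n (fun w => x (phi w)) mu)
      @ \oo --> (0 : R).

Definition borelT := g_sigma_algebraType (@open T).

Definition ergodic_prob_functional (phi : T -> T) (nu : (T -> R) -> R) : Prop :=
  exists P : probability borelT R,
    (forall x : T -> R, continuous x ->
        (\int[P]_w (x w)%:E = (nu x)%:E)%E) /\
    (forall A : set borelT, measurable A -> P (phi @^-1` A) = P A) /\
    (forall A : set borelT, measurable A -> phi @^-1` A = A ->
        P A = 0%E \/ P A = 1%E).

Definition ergodically_decomposable (phi : T -> T) : Prop :=
  exists (c : nat -> nat -> R) (N : nat -> nat)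
         (Q : ((T -> R) -> R) -> ((T -> R) -> R)),
    convex_weights c N /\
    ergodic_seq phi c N /\
    (forall mu, is_dual mu -> is_dual (Q mu)) /\
    (forall (x : T -> R) (mu : (T -> R) -> R), continuous x -> is_dual mu ->
        (fun n => Vn_pair phi c N n x mu) @ \oo --> Q mu x) /\
    (forall w0 : T, ergodic_prob_functional phi (Q (dirac_fun w0))).

Definition tame (phi : T -> T) : Prop :=
  forall (x : T -> R) (nk : nat -> nat), continuous x ->
    (forall k, (nk k < nk k.+1)%N) ->
    forall eps : R, 0 < eps ->
      exists (K : nat) (a : nat -> R),
        \sum_(k < K) `|a k| = 1 /\
        forall w : T, `|\sum_(k < K) a k * x (iter (nk k) phi w)| <= eps.

End Defs.

(* Main.v *)
Require Import Defs.
From HB Require Import structures.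
From mathcomp Require Import all_boot all_order all_algebra.
From mathcomp Require Import all_classical all_reals all_analysis.
From mathcomp Require Import measurable_realfun ring lra.
Set Implicit Arguments. Unset Strict Implicit. Unset Printing Implicit Defensive.
Import Order.TTheory GRing.Theory Num.Theory.
Import numFieldNormedType.Exports.
Local Open Scope classical_set_scope.
Local Open Scope ring_scope.

(* Let m be an extreme point of the shift-invariant means on bounded sequences.
   The functional nu_w : x |-> m (k |-> x (phi^k w)) is a phi-invariant probability
   measure, and it is ergodic: were A an invariant set with 0 < nu_w A < 1, weighting
   m by continuous approximations of 1_A along the orbit of w would split m.

   It remains to reach nu_w for all w at once by a sequence of convex combinations
   of the V^k.  Choose an ultrafilter q on finite convex combinations of Dirac masses
   converging to m.  Tameness says that an orbit of x has no independent subsequence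
   in the sense of Rosenthal, and this passes to the convex hull: the functions
   x o phi^k form a totally bounded set in L1 of every measure, whereas an
   independent sequence is separated in L1 of a Bernoulli measure.  A family without
   independent sequences is, along q, uniformly Cauchy up to any e > 0 on each of
   countably many sets covering the space, so a diagonal choice of elements of q
   yields a sequence converging pointwise to nu.  Pointwise bounded convergence
   implies convergence against every bounded functional, by the Riesz representation
   of its total variation and dominated convergence. *)

(** * Ultrafilter limits *)

(** Cesàro averages would not do: if an orbit lingers alternately near two fixed points for slowly
    growing times, they converge to a proper mixture of two Dirac measures. Ergodicity must hold at
    every [w] for one and the same sequence, so extremality is imposed on the mean [m] over [nat],
    which does not depend on [w], and every orbit inherits it. The price is that [m] is a priori
    reached only along an ultrafilter. A plain diagonal choice could handle countably many points,
    but there are uncountably many [w]; hence countably many members of [q] have to serve all points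
    at once, and hence independence has to be excluded for convex combinations and not just for the
    functions [x (iter k phi w)]. The limit may be discontinuous in [w], so convergence against a
    functional comes from a Cauchy argument. The resulting sequence is ergodic because shift
    invariance of [m] makes the limits for [x] and for [x] composed with [phi] agree at each
    point. *)

Section ultralimits.
Variables (R : realType) (I : Type) (q : set_system I).
Hypothesis qU : UltraFilter q.

Definition ulim (u : I -> R) : R := lim (u @ q).

(** The bound is asked on a member of [q] only: in [ulim_invariant_mean] the ultrafilter lives on
    all functionals, and only those in its member [invariant_mean] are known to be bounded. *)
Definition ubounded (u : I -> R) := exists b : R, q [set i | `|u i| <= b].

(** The image of [q] is an ultrafilter containing the compact segment [[-b, b]], so it converges and
    [lim] is a genuine limit rather than a default value. *)
Lemma ulimP u : ubounded u -> forall e : R, 0 < e -> q [set i | `|u i - ulim u| <= e].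
Proof.
move=> [b qb].
have uU : UltraFilter (u @ q).
  split=> [|G GF uG]; first exact: fmap_proper_filter.
  apply/seteqP; split=> // A GA.
  have [//|nA] := in_ultra_setVsetC (u @^-1` A) qU.
  by have [x []] := filter_ex (filterI GA (uG (~` A) nA)).
have := @segment_compact R (- b) b; rewrite compact_ultra.
move=> /(_ _ uU) [|l [_ ul]].
  by apply: (filterS _ qb : q (u @^-1` _)) => i /=; rewrite in_itv/= ler_norml.
have -> : ulim u = l by apply/cvg_lim.
by move=> e e0; move/cvgrPdist_le : ul => /(_ e e0); apply: filterS => i /=; rewrite distrC.
Qed.

Lemma ulimE u l : (forall e : R, 0 < e -> q [set i | `|u i - l| <= e]) -> ulim u = l.
Proof.
move=> h; apply/cvg_lim => //; apply/cvgrPdist_le => e e0.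
by apply: filterS (h e e0) => i /=; rewrite distrC.
Qed.

Lemma ubounded_all u (b : R) : (forall i, `|u i| <= b) -> ubounded u.
Proof. by move=> h; exists b; apply: filterS filterT => i _ /=. Qed.

Lemma ubounded_cst a : ubounded (fun=> a).
Proof. exact: (@ubounded_all _ `|a|). Qed.

Lemma uboundedD u v : ubounded u -> ubounded v -> ubounded (fun i => u i + v i).
Proof.
move=> [a ha] [b hb]; exists (a + b); apply: filterS2 ha hb => i /= h1 h2.
by rewrite (le_trans (ler_normD _ _))// lerD.
Qed.

Lemma uboundedZ a u : ubounded u -> ubounded (fun i => a * u i).
Proof.
move=> [b hb]; exists (`|a| * b); apply: filterS hb => i /= h1.
by rewrite normrM ler_wpM2l.
Qed.

Lemma ulim_cst a : ulim (fun=> a) = a.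
Proof.
apply: ulimE => e e0; apply: filterS filterT => i _ /=.
by rewrite subrr normr0 ltW.
Qed.

Lemma ulimD u v : ubounded u -> ubounded v ->
  ulim (fun i => u i + v i) = ulim u + ulim v.
Proof.
move=> hu hv; apply: ulimE => e e0; have e2 : 0 < e / 2 by lra.
apply: filterS2 (ulimP hu e2) (ulimP hv e2) => i /=; rewrite !ler_norml; lra.
Qed.

Lemma ulimZ a u : ubounded u -> ulim (fun i => a * u i) = a * ulim u.
Proof.
move=> hu; have a1 : 0 < `|a| + 1 by rewrite ltr_wpDl.
apply: ulimE => e e0; have e2 : 0 < e / (`|a| + 1) by rewrite divr_gt0.
apply: filterS (ulimP hu e2) => i /= h.
rewrite -mulrBr normrM (le_trans (ler_wpM2l _ h))//.
rewrite mulrCA ler_piMr ?(ltW e0)// ler_pdivrMr// mul1r; lra.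
Qed.

Lemma ulim_le u v : ubounded u -> ubounded v -> q [set i | u i <= v i] ->
  ulim u <= ulim v.
Proof.
move=> hu hv huv; apply/ler_addgt0Pr => e e0; have e2 : 0 < e / 2 by lra.
have [i] := filter_ex (filterI huv (filterI (ulimP hu e2) (ulimP hv e2))).
rewrite /= !ler_norml; lra.
Qed.

Lemma ulim_norm_le u (b : R) : q [set i | `|u i| <= b] -> `|ulim u| <= b.
Proof.
move=> qb; have hu : ubounded u by exists b.
rewrite ler_norml; apply/andP; split.
- rewrite -(ulim_cst (- b)); apply: ulim_le => //.
    exact: ubounded_cst.
  by apply: filterS qb => i /=; rewrite ler_norml => /andP[].
- rewrite -(ulim_cst b); apply: ulim_le => //.
    exact: ubounded_cst.
  by apply: filterS qb => i /=; rewrite ler_norml => /andP[].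
Qed.

End ultralimits.

Lemma nonprincipal_ultra : exists q : set_system nat, UltraFilter q /\
  (forall n, q [set k | (n < k)%N]).
Proof.
have [q [qU sq]] := ultraFilterLemma eventually_filter.
by exists q; split => // n; apply: sq; exists n.+1.
Qed.

(** * Continuous functions supported on open sets *)

Section compact_metric.
Variables (R : realType) (T : pseudoPMetricType R).

(** The witness is the distance to the complement of [U] cut off at 1, written as a supremum of
    radii so that it also makes sense for [U = setT]. The radius 0 keeps the set of radii nonempty
    outside [U]. *)
Lemma open_support (U : set T) : open U ->
  exists f : T -> R, [/\ continuous f, forall x, 0 <= f x <= 1 &
    forall x, (0 < f x) <-> U x].
Proof.
move=> oU.
pose S x := [set e : R | e = 0 \/ 0 < e <= 1 /\ ball x e `<=` U].
have S0 x : S x 0 by left.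
have ubS x : ubound (S x) 1 by move=> e [->//|[/andP[]]].
have hS x : has_sup (S x) by split; [exists 0|exists 1].
pose f x := sup (S x).
have f0 x : 0 <= f x by apply: ub_le_sup; [exists 1|].
have key x y d : 0 < d -> ball x d y -> f x <= f y + d.
  move=> d0 xy; apply: ge_sup; first by exists 0.
  move=> e [->|[/andP[e0 e1] eU]]; first by rewrite addr_ge0// ltW.
  have [ed|ed] := leP e d; first by rewrite (le_trans ed)// ler_wpDl.
  rewrite -lerBlDr; apply: ub_le_sup; first by exists 1.
  right; split; first by apply/andP; split; lra.
  move=> z yz; apply: eU; rewrite -(subrKC d e); exact: ball_triangle xy yz.
exists f; split.
- move=> x; apply/cvgrPdist_le => e e0.
  near=> y.
  have xy : ball x e y by near: y; exact: nbhsx_ballx.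
  have := key _ _ _ e0 xy; have := key _ _ _ e0 (ball_sym xy).
  rewrite ler_norml; lra.
- by move=> x; rewrite f0/=; apply: ge_sup; [exists 0|exact: ubS].
- move=> x; split.
    move=> fx; have [e [->|[/andP[e0 _] eU] _]] := sup_gt (ex_intro _ 0 (S0 x)) fx.
      by rewrite ltxx.
    by apply: eU; exact: ballxx.
  move=> Ux; have /nbhs_ballP[e e0 eU] : nbhs x U by exact: open_nbhs_nbhs.
  apply: (@lt_le_trans _ _ (Num.min e 1)); first by rewrite lt_min e0 ltr01.
  apply: ub_le_sup; first by exists 1.
  right; split; first by rewrite lt_min e0 ltr01 ge_min lexx orbT.
  by apply: subset_trans eU; apply: le_ball; rewrite ge_min lexx.
Unshelve. all: by end_near. Qed.

End compact_metric.

(** * Independent sequences *)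

Section covering.
Variables (R : realType) (T : topologicalType).

(** Rosenthal's independence, tested on initial segments: a sign sequence encodes a pair of disjoint
    finite index sets. Strict inequalities make the cells of continuous functions open. *)
Definition independent (g : nat -> T -> R) (r s : R) :=
  forall n (sg : nat -> bool), exists w, forall j, (j < n)%N ->
    if sg j then s < g j w else g j w < r.

Variables (I : Type) (q : set_system I) (g : I -> T -> R) (b : R).
(** [lt] will be [<] on [nat] when subsequences are selected and the full relation when convex
    combinations are. *)
Variable lt : I -> I -> Prop.
Hypothesis qU : UltraFilter q.
Hypothesis gc : forall i, continuous (g i).
Hypothesis gb : forall i w, `|g i w| <= b.
Hypothesis qlt : forall i, q (lt i).
Hypothesis noind : forall (r s : R) (i : nat -> I), r < s ->
  (forall n, lt (i n) (i n.+1)) -> ~ independent (fun n => g (i n)) r s.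

Section tree.
Variables (r s : R).

(** The list is in reverse order of choice: its head carries the bit [size l'], so prepending an
    index leaves the earlier bits in place. *)
Fixpoint cell (l : seq I) (sg : nat -> bool) : set T :=
  if l is i :: l' then
    cell l' sg `&` [set w | if sg (size l') then s < g i w else g i w < r]
  else setT.

Lemma eq_cell l sg sg' : (forall j, (j < size l)%N -> sg j = sg' j) ->
  cell l sg = cell l sg'.
Proof.
elim: l => //= i l ih h; rewrite ih; last by move=> j jl; apply: h; exact: ltnW.
by rewrite h.
Qed.

Lemma open_cell l sg : open (cell l sg).
Proof.
elim: l => [|i l ih] /=; first exact: openT.
apply: openI => //; case: (sg _).
- by apply: (@open_comp _ _ (g i) [set y | s < y]) => // x _; exact: gc.
- by apply: (@open_comp _ _ (g i) [set y | y < r]) => // x _; exact: gc.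
Qed.

(** If both alternatives failed for every open [U] meeting [E], then [q]-almost every [i] would take
    values above [s] and below [r] on each such [U]. Cells are open, so a finite list all of whose
    cells meet [E] could be extended by almost every [i]; iterating would contradict [noind]. *)
Lemma localization (E : set T) : r < s -> E !=set0 ->
  exists U, [/\ open U, U `&` E !=set0 &
    q [set i | forall w, U w -> E w -> g i w <= s] \/
    q [set i | forall w, U w -> E w -> r <= g i w]].
Proof.
move=> rs E0; apply: contrapT => hno.
have above U : open U -> U `&` E !=set0 ->
    q [set i | exists w, [/\ U w, E w & s < g i w]].
  move=> oU UE.
  have [h|//] := in_ultra_setVsetC [set i | forall w, U w -> E w -> g i w <= s] qU.
    by exfalso; apply: hno; exists U; split => //; left.
  apply: filterS => i /=; apply: contra_notP => h w Uw Ew.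
  by rewrite leNgt; apply/negP => sw; apply: h; exists w.
have below U : open U -> U `&` E !=set0 ->
    q [set i | exists w, [/\ U w, E w & g i w < r]].
  move=> oU UE.
  have [h|//] := in_ultra_setVsetC [set i | forall w, U w -> E w -> r <= g i w] qU.
    by exfalso; apply: hno; exists U; split => //; right.
  apply: filterS => i /=; apply: contra_notP => h w Uw Ew.
  by rewrite leNgt; apply/negP => sw; apply: h; exists w.
pose good l := forall sg, cell l sg `&` E !=set0.
have extend l : good l -> q [set i | good (i :: l)].
  move=> gl.
  (* A cell depends only on the first [size l] bits, and [q] is closed under finite intersections
     only; hence the quantification over tuples instead of sign sequences. *)
  have H : q [set i | forall t : (size l).-tuple bool,
      (exists w, [/\ cell l (nth false t) w, E w & s < g i w]) /\
      (exists w, [/\ cell l (nth false t) w, E w & g i w < r])].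
    apply: (@filter_forall _ _ _ q) => t.
    have ot : open (cell l (nth false t)) by exact: open_cell.
    exact: filterI (above _ ot (gl _)) (below _ ot (gl _)).
  apply: filterS H => i h sg; rewrite /good /=.
  have et : cell l sg = cell l (nth false [tuple sg j | j < size l]).
    apply: eq_cell => j jl.
    by rewrite (_ : j = Ordinal jl)// -tnth_nth tnth_mktuple.
  have [[w1 [c1 E1 h1]] [w2 [c2 E2 h2]]] := h [tuple sg j | j < size l].
  rewrite et; case: (sg (size l)); first by exists w1.
  by exists w2.
have pick l : exists i, good l ->
    good (i :: l) /\ (if l is j :: _ then lt j i else True).
  have [gl|ngl] := pselect (good l); last first.
    have [i _] := filter_ex (@filterT _ q _).
    by exists i.
  have hl : q [set i | if l is j :: _ then lt j i else True].
    by case: (l) => [|j _]; [exact: filterT|exact: qlt].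
  by have [i [h1 h2]] := filter_ex (filterI (extend l gl) hl); exists i.
have {}[f fP] := choice pick.
pose L := fix L n := if n is m.+1 then f (L m) :: L m else [::].
have sL n : size (L n) = n by elim: n => //= n ->.
have gL n : good (L n).
  elim: n => [sg|n ih]; first by case: E0 => w Ew; exists w.
  by have [] := fP _ ih.
apply: (noind (i := fun n => f (L n)) rs).
  by move=> n; have [_] := fP _ (gL n.+1).
move=> n sg; have [w [cw _]] := gL n sg; exists w => j.
elim: n cw => //= n ih [cw]; rewrite sL ltnS leq_eqVlt => hw.
by case/predU1P => [->//|]; exact: ih.
Qed.

End tree.

(** Apply [localization] at the two inner thirds of the current range of values: either alternative
    removes one third of the range on a smaller open set still meeting [E], so the length decays
    like [(2 / 3) ^+ n]. *)
Lemma small_oscillation (E : set T) (e : R) : E !=set0 -> 0 < e ->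
  exists U, [/\ open U, U `&` E !=set0 &
    exists c, q [set i | forall w, U w -> E w -> c <= g i w <= c + e]].
Proof.
move=> E0 e0.
have [w0 _] := E0.
have [i0 _] := filter_ex (@filterT _ q _).
have b0 : 0 <= b by rewrite (le_trans _ (gb i0 w0)).
have step n : exists U, [/\ open U, U `&` E !=set0 & exists c,
    q [set i | forall w, U w -> E w -> c <= g i w <= c + 2 * b * (2 / 3) ^+ n]].
  elim: n => [|n [U [oU UE [c hc]]]].
    exists setT; split; [exact: openT|by rewrite setTI|exists (- b)].
    apply: filterS filterT => i _ w _ _; rewrite expr0.
    by move: (gb i w); rewrite ler_norml; lra.
  set L := 2 * b * _ in hc.
  (* The length [L] vanishes when [b = 0], and the two thirds then coincide. *)
  have [L0|L0] := leP L 0.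
    exists U; split => //; exists c; apply: filterS hc => i h w Uw Ew.
    have /andP[h1 h2] := h w Uw Ew.
    by rewrite exprS mulrCA h1/= -/L; lra.
  have rs : c + L / 3 < c + L * (2 / 3) by lra.
  have [V [oV VE hV]] := localization rs UE.
  have {}VE : (V `&` U) `&` E !=set0 by rewrite -setIA.
  rewrite exprS mulrCA -/L; case: hV.
  - move=> hV; exists (V `&` U); split => //; first exact: openI.
    exists c; apply: filterS2 hc hV => i h1 h2 w [Vw Uw] Ew.
    have := h1 w Uw Ew; have := h2 w Vw (conj Uw Ew); lra.
  - move=> hV; exists (V `&` U); split => //; first exact: openI.
    exists (c + L / 3); apply: filterS2 hc hV => i h1 h2 w [Vw Uw] Ew.
    have := h1 w Uw Ew; have := h2 w Vw (conj Uw Ew); lra.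
have : (fun n => 2 * b * (2 / 3 : R) ^+ n) @ \oo --> (2 * b * 0).
  apply: cvgMr; apply: cvg_expr; rewrite ger0_norm; lra.
rewrite mulr0 => /cvgrPdist_le/(_ _ e0)[n _ /(_ n (leqnn n))].
rewrite sub0r normrN => /ler_normlW hn.
have [U [oU UE [c hc]]] := step n.
exists U; split => //; exists c; apply: filterS hc => i h w Uw Ew.
have := h w Uw Ew; lra.
Qed.

(* This plays the role of the Baire class 1 property of the [q]-limit: choosing
   diagonally in the sets [M n] approximates that limit pointwise by a sequence. *)
Lemma countable_cover (e : R) : @second_countable T -> 0 < e ->
  exists M : nat -> set I, (forall n, q (M n)) /\
    forall w, exists n, forall i j, M n i -> M n j -> `|g i w - g j w| <= e.
Proof.
move=> [B cB [oB bB]] e0.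
(* [sig] is a sigma-ideal, and [Z] is a member containing every basic open set that belongs to it.
   If [Z] were not everything, [small_oscillation] on its complement would give a basic set [V] that
   leaves [Z]; but [V] lies in [sig], being covered by [Z] and one piece of small oscillation. *)
pose sig (X : set T) := exists M : nat -> set I, (forall n, q (M n)) /\
  forall w, X w -> exists n, forall i j, M n i -> M n j -> `|g i w - g j w| <= e.
have sigU (F : nat -> set T) : (forall n, sig (F n)) -> sig (\bigcup_n F n).
  move=> /choice[M MP].
  pose N k := if @unpickle (nat * nat)%type k is Some p then M p.1 p.2 else setT.
  exists N; split.
    move=> k; rewrite /N; case: unpickle => [p|]; last exact: filterT.
    by have [+ _] := MP p.1; exact.
  move=> w [n _ Fw]; have [_ /(_ w Fw)[m hm]] := MP n.
  by exists (pickle (n, m)); rewrite /N pickleK.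
have sigS (X Y : set T) : X `<=` Y -> sig Y -> sig X.
  by move=> XY [M [qM hM]]; exists M; split => // w /XY; exact: hM.
have sig0 : sig set0.
  by exists (fun=> setT); split => // n; exact: filterT.
pose C := B `&` sig.
have [Z [sZ CZ]] : exists Z, sig Z /\ forall U, C U -> U `<=` Z.
  have /pfcard_geP[C0|[F]] : (C #<= [set: nat])%card.
    by apply: sub_countable cB; apply: subset_card_le; exact: subIsetl.
  - by exists set0; split => // U; rewrite C0.
  - exists (\bigcup_n F n); split.
      by apply: sigU => n; have [] := @funS _ _ _ _ F n Logic.I.
    move=> U CU w Uw; have [n _ nU] := @surj _ _ _ _ F _ CU.
    by exists n => //; rewrite nU.
apply: contrapT => hno.
have [w0 nZ] : exists w, ~ Z w.
  apply: contrapT => h; apply: hno; case: sZ => M [qM hM]; exists M; split => // w.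
  by apply: hM; apply: contrapT => nZ; apply: h; exists w.
have [U [oU [w [Uw nZw]] [c hc]]] := @small_oscillation (~` Z) e (ex_intro _ w0 nZ) e0.
have [V [BV Vw] VU] := bB w U (open_nbhs_nbhs (conj oU Uw)).
apply: nZw; apply: (CZ V) => //; split => //.
apply: (@sigS _ (\bigcup_n (if n is 0%N then Z else V `\` Z))).
  move=> y Vy; have [Zy|nZy] := pselect (Z y); first by exists 0%N.
  by exists 1%N.
apply: sigU => -[//|_].
exists (fun=> [set i | forall w, U w -> (~` Z) w -> c <= g i w <= c + e]).
split => // y [Vy nZy]; exists 0%N => i j /(_ y (VU _ Vy) nZy) hi /(_ y (VU _ Vy) nZy) hj.
by rewrite ler_norml; lra.
Qed.

End covering.

(** * Continuous real functions and compactness *)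

Section continuity.
Variables (R : realType) (T : topologicalType).
Implicit Types f g : T -> R.

Lemma cont_cst (a : R) : continuous (fun _ : T => a).
Proof. by move=> x; exact: cvg_cst. Qed.

Lemma cont_add f g : continuous f -> continuous g -> continuous (fun w => f w + g w).
Proof. by move=> cf cg x; apply: cvgD; [exact: cf|exact: cg]. Qed.

Lemma cont_sub f g : continuous f -> continuous g -> continuous (fun w => f w - g w).
Proof. by move=> cf cg x; apply: cvgB; [exact: cf|exact: cg]. Qed.

Lemma cont_mul f g : continuous f -> continuous g -> continuous (fun w => f w * g w).
Proof. by move=> cf cg x; apply: cvgM; [exact: cf|exact: cg]. Qed.

Lemma cont_scale (a : R) f : continuous f -> continuous (fun w => a * f w).
Proof. by move=> cf; apply: cont_mul => //; exact: cont_cst. Qed.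

Lemma cont_norm f : continuous f -> continuous (fun w => `|f w|).
Proof. by move=> cf x; apply: cvg_norm; exact: cf. Qed.

Lemma cont_min f g : continuous f -> continuous g ->
  continuous (fun w => Num.min (f w) (g w)).
Proof. by move=> cf cg x; exact: (@continuous_min R T f g x (cf x) (cg x)). Qed.

Lemma cont_max f g : continuous f -> continuous g ->
  continuous (fun w => Num.max (f w) (g w)).
Proof. by move=> cf cg x; exact: (@continuous_max R T f g x (cf x) (cg x)). Qed.

Lemma cont_sum n (f : nat -> T -> R) : (forall i, continuous (f i)) ->
  continuous (fun w => \sum_(i < n) f i w).
Proof.
move=> cf; elim: n => [|n ih].
  by under eq_fun do rewrite big_ord0; exact: cont_cst.
by under eq_fun do rewrite big_ord_recr /=; exact: cont_add.
Qed.

Lemma open_preim_gt f (a : R) : continuous f -> open [set w | a < f w].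
Proof. by move=> cf; apply: (@open_comp _ _ f [set y | a < y]) => // x _; exact: cf. Qed.

Lemma open_preim_lt f (a : R) : continuous f -> open [set w | f w < a].
Proof. by move=> cf; apply: (@open_comp _ _ f [set y | y < a]) => // x _; exact: cf. Qed.

Lemma closed_preim_ge f (a : R) : continuous f -> closed [set w | a <= f w].
Proof. by move=> cf; apply: (@closed_comp _ _ f [set y | a <= y]) => // x _; exact: cf. Qed.

End continuity.

Lemma compact_bounded (R : realType) (T : topologicalType) (f : T -> R) :
  compact [set: T] -> continuous f -> exists b : R, forall w, `|f w| <= b.
Proof.
move=> cT cf; have := @continuous_compact _ _ f [set: T] (fun x => @continuous_subspaceT _ _ _ _ cf x) cT.
move/compact_bounded => [M [_ hM]]; exists (M + 1) => w.
by apply: (hM (M + 1)); [rewrite ltrDl|exists w].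
Qed.

Lemma compact_increasing_cover (T : ptopologicalType) (K : set T) (O : nat -> set T) :
  compact [set: T] -> closed K -> (forall n, open (O n)) ->
  (forall n m, (n <= m)%N -> O n `<=` O m) -> K `<=` \bigcup_n O n ->
  exists n, K `<=` O n.
Proof.
move=> cT cK oO incO KO.
have : compact K by apply: subclosed_compact cK cT _.
rewrite compact_cover => /(_ _ setT O (fun n _ => oO n) KO)[D _ DK].
exists (\max_(i <- finmap.enum_fset D) i)%N => x /DK[i /= iD Oix].
apply: (incO i) => //; exact: (@leq_bigmax_seq _ _ xpredT id).
Qed.

(** * Riesz representation on a compact metric space *)

Section Riesz.
Variables (R : realType) (T : pseudoPMetricType R).

(** Linearity is required on nonnegative functions only: this is all that the total variation in
    [dual_majorant] provides. *)
Definition positive_functional (lam : (T -> R) -> R) := [/\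
  forall f : T -> R, continuous f -> (forall w, 0 <= f w) -> 0 <= lam f,
  forall f g : T -> R, continuous f -> continuous g -> (forall w, 0 <= f w) ->
    (forall w, 0 <= g w) -> lam (fun w => f w + g w) = lam f + lam g &
  forall (a : R) (f : T -> R), 0 <= a -> continuous f -> (forall w, 0 <= f w) ->
    lam (fun w => a * f w) = a * lam f].

Definition below (U : set T) : set (T -> R) :=
  [set f : T -> R | [/\ continuous f, forall w, 0 <= f w <= 1 & forall w, 0 < f w -> U w]].

Variable lam : (T -> R) -> R.
Hypothesis cT : compact [set: T].
Hypothesis hl : positive_functional lam.

Let lam_ge0 (f : T -> R) : continuous f -> (forall w, 0 <= f w) -> 0 <= lam f.
Proof. by case: hl => h _ _; exact: h. Qed.

Lemma positive_functional_le (f g : T -> R) : continuous f -> continuous g ->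
  (forall w, 0 <= f w <= g w) -> lam f <= lam g.
Proof.
move=> cf cg h; case: hl => h0 hD _.
have -> : lam g = lam (fun w => f w + (g w - f w)).
  by congr lam; apply/funext => w; rewrite subrKC.
have h1 w : 0 <= f w by case/andP: (h w).
have h2 w : 0 <= g w - f w by rewrite subr_ge0; case/andP: (h w).
rewrite hD//; last exact: cont_sub.
by rewrite lerDl h0//; exact: cont_sub.
Qed.

Lemma positive_functional0 : lam (fun=> 0) = 0.
Proof.
case: hl => _ _ hZ.
have := hZ 0 (fun=> 0) (lexx 0) (@cont_cst _ _ _) (fun=> lexx 0).
by rewrite /= (mul0r (0 : R)) mul0r.
Qed.

Lemma positive_functional_sum n (f : nat -> T -> R) :
  (forall i, continuous (f i)) -> (forall i w, 0 <= f i w) ->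
  lam (fun w => \sum_(i < n) f i w) = \sum_(i < n) lam (f i).
Proof.
move=> cf f0; case: hl => _ hD _; elim: n => [|n ih].
  rewrite big_ord0; apply: etrans positive_functional0; congr lam.
  by apply/funext => w; rewrite big_ord0.
rewrite big_ord_recr/= -ih -hD//.
- by congr lam; apply/funext => w; rewrite big_ord_recr.
- exact: cont_sum.
- by move=> w; apply: sumr_ge0.
Qed.

Let cont_cut (f : T -> R) (e : R) : continuous f -> continuous (fun w => Num.max (f w - e) 0).
Proof. by move=> cf; apply: cont_max; [apply: cont_sub => //|]; exact: cont_cst. Qed.

(** The class [below U] does not ask for a compact support inside [U]. Cutting at height [e]
    supplies one, since [max (f - e) 0] lives on the closed set [e <= f], and this lemma prices the
    cut. *)
Lemma positive_functional_cut (f : T -> R) (e : R) : continuous f -> (forall w, 0 <= f w) -> 0 <= e ->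
  lam f <= lam (fun w => Num.max (f w - e) 0) + e * lam (fun=> 1).
Proof.
move=> cf f0 e0; case: hl => h0 hD hZ.
have c1 := @cont_cst R T 1.
have ce := @cont_cst R T (e * 1).
have cc := @cont_cut f e cf.
rewrite -hZ//.
rewrite -hD//; last 2 first.
- by move=> w; rewrite le_max lexx orbT.
- by move=> w; rewrite mulr1.
apply: positive_functional_le => //; first exact: cont_add.
move=> w; rewrite f0/= mulr1.
by have := le_max (f w - e) (f w - e) 0; rewrite lexx/= => h; lra.
Qed.

Definition inner_measure U : \bar R := ereal_sup [set (lam f)%:E | f in below U].

Definition outer_measure_of A : \bar R :=
  ereal_inf [set inner_measure U | U in [set U | open U /\ A `<=` U]].

Local Notation inner := inner_measure.
Local Notation outer := outer_measure_of.

Let below0 U : below U (fun=> 0).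
Proof.
by split => [|w|w]; [exact: cont_cst|rewrite lexx ler01|rewrite ltxx].
Qed.

Let inner_ub U f : below U f -> ((lam f)%:E <= inner U)%E.
Proof. by move=> bf; apply: ereal_sup_ubound; exists f. Qed.

Let inner_ge0 U : (0 <= inner U)%E.
Proof. by have := inner_ub (below0 U); rewrite positive_functional0. Qed.

Let inner_le1 U : (inner U <= (lam (fun=> 1))%:E)%E.
Proof.
apply: ge_ereal_sup => _ [f [cf f01 _] <-]; rewrite lee_fin.
by apply: positive_functional_le => //; exact: cont_cst.
Qed.

Let inner_fin U : inner U \is a fin_num.
Proof.
apply/fin_real; rewrite (lt_le_trans _ (inner_ge0 U)) ?ltNyr//=.
by rewrite (le_lt_trans (inner_le1 U)) ?ltry.
Qed.

Let inner_mono U V : U `<=` V -> (inner U <= inner V)%E.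
Proof.
move=> UV; apply: ereal_sup_le => _ [f [cf f01 fU] <-]; exists f => //.
by split => // w /fU/UV.
Qed.

Let inner_adh U (e : R) : 0 < e -> exists2 f, below U f & (inner U <= (lam f + e)%:E)%E.
Proof.
move=> e0; have [_ [f bf <-] h] := ub_ereal_sup_adherent e0 (inner_fin U).
by exists f => //; rewrite EFinD -leeBlDr// ltW.
Qed.

Let outer_open U : open U -> outer U = inner U.
Proof.
move=> oU; apply/eqP; rewrite eq_le; apply/andP; split.
  by apply: ereal_inf_lbound; exists U; [split|].
by apply: le_ereal_inf_tmp => _ [V [_ UV] <-]; exact: inner_mono.
Qed.

Let outer_le A U : open U -> A `<=` U -> (outer A <= inner U)%E.
Proof. by move=> oU AU; apply: ereal_inf_lbound; exists U; [split|]. Qed.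

Let outer_ge0 A : (0 <= outer A)%E.
Proof. by apply: le_ereal_inf_tmp => _ [U _ <-]. Qed.

Let outer_fin A : outer A \is a fin_num.
Proof.
apply/fin_real; rewrite (lt_le_trans _ (outer_ge0 A)) ?ltNyr//=.
by rewrite (le_lt_trans (outer_le openT (@subsetT _ A)))// (le_lt_trans (inner_le1 _))// ltry.
Qed.

Let outer_mono A B : A `<=` B -> (outer A <= outer B)%E.
Proof.
move=> AB; apply: ereal_inf_le_tmp => _ [U [oU BU] <-]; exists U => //.
by split => //; exact: subset_trans BU.
Qed.

Let outer_adh A (e : R) : 0 < e ->
  exists U, [/\ open U, A `<=` U & (inner U <= outer A + e%:E)%E].
Proof.
move=> e0; have [_ [U [oU AU] <-] h] := lb_ereal_inf_adherent e0 (outer_fin A).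
by exists U; split => //; exact: ltW.
Qed.

(* The slices between successive truncations of [f] by [N (e_0 + ... + e_(i-1))],
   with [e_i] supported on [U_i], play the role of a partition of unity. *)
Let inner_subadditive (U : nat -> set T) f : (forall n, open (U n)) ->
  below (\bigcup_n U n) f -> ((lam f)%:E <= \sum_(n <oo) inner (U n))%E.
Proof.
move=> oU [cf f01 fU].
have /choice[e eP] n : exists e : T -> R, [/\ continuous e, forall x, 0 <= e x <= 1 &
    forall x, (0 < e x) <-> U n x] by exact: open_support.
have ec n : continuous (e n) by case: (eP n).
have e0 n w : 0 <= e n w by case: (eP n) => _ /(_ w)/andP[].
have eU n w : 0 < e n w -> U n w by case: (eP n) => _ _ /(_ w)[].
pose S n w := \sum_(i < n) e i w.
have cS n : continuous (S n) by exact: cont_sum.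
have S0 n w : 0 <= S n w by apply: sumr_ge0.
have SS n w : S n.+1 w = S n w + e n w by rewrite /S big_ord_recr.
have Smono n m w : (n <= m)%N -> S n w <= S m w.
  by move/subnKC <-; elim: (m - n)%N => [|k ih]; rewrite ?addn0// addnS SS (le_trans ih)// lerDl.
have lam1 : 0 <= lam (fun=> 1) by apply: lam_ge0; [exact: cont_cst|].
apply/lee_addgt0Pr => d d0.
pose t := d / (lam (fun=> 1) + 1).
have t0 : 0 < t by rewrite divr_gt0// ltr_wpDl.
have td : t * lam (fun=> 1) <= d.
  by rewrite /t mulrAC ler_pdivrMr ?ltr_wpDl// ler_wpM2l ?(ltW d0)// lerDl.
have [N hN] : exists n, [set w | t <= f w] `<=` [set w | 1 < n%:R * S n w].
  apply: compact_increasing_cover => //.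
  - exact: closed_preim_ge.
  - by move=> n; apply: open_preim_gt; exact: cont_scale.
  - move=> n m nm w /= h; apply: (lt_le_trans h).
    by apply: ler_pM => //; [rewrite ler_nat|exact: Smono].
  - move=> w /= tw; have [n _ Unw] := fU w (lt_le_trans t0 tw).
    have en : 0 < e n w by case: (eP n) => _ _ /(_ w)[_]; exact.
    (* The index is both the number of summands and the factor: it must exceed [n], so that [e n]
       enters the sum, and the inverse of [S n.+1 w], so that the product exceeds 1. *)
    pose k := maxn n.+1 (Num.truncn (S n.+1 w)^-1).+1.
    have Sn0 : 0 < S n.+1 w by rewrite SS ltr_wpDl.
    exists k => //=; apply: (@lt_le_trans _ _ (k%:R * S n.+1 w)).
      rewrite -ltr_pdivrMr// div1r (lt_le_trans (truncnS_gt _))// ler_nat.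
      exact: leq_maxr.
    by rewrite ler_wpM2l// Smono// leq_maxl.
pose g w := Num.max (f w - t) 0.
have cg : continuous g by exact: cont_cut.
have g0 w : 0 <= g w by rewrite le_max lexx orbT.
have g1 w : g w <= 1 by rewrite ge_max ler01 andbT; have /andP[] := f01 w; lra.
pose G n w := Num.min (g w) (N%:R * S n w).
have cG n : continuous (G n) by apply: cont_min => //; exact: cont_scale.
have G0 n w : 0 <= G n w by rewrite le_min g0 mulr_ge0.
have Gg n w : G n w <= g w by rewrite ge_min lexx.
have GS n w : G n w <= G n.+1 w.
  rewrite le_min Gg/=; apply: (@le_trans _ _ (N%:R * S n w)); first by rewrite ge_min lexx orbT.
  by rewrite ler_wpM2l// Smono.
have G00 w : G 0%N w = 0 by rewrite /G /S big_ord0 mulr0; apply/min_idPr.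
have GN w : G N w = g w.
  apply/min_idPl; have [tw|tw] := leP t (f w); first by rewrite (le_trans (g1 w))// ltW//; exact: hN.
  by rewrite /g max_r ?mulr_ge0// subr_le0 ltW.
have sumG : lam g = \sum_(i < N) lam (fun w => G i.+1 w - G i w).
  rewrite -(positive_functional_sum N (f := fun i w => G i.+1 w - G i w)).
  - congr lam; apply/funext => w.
    by rewrite -(big_mkord xpredT (fun i => G i.+1 w - G i w)) telescope_sumr// GN G00 subr0.
  - by move=> i; exact: cont_sub.
  - by move=> i w; rewrite subr_ge0.
have hcut := positive_functional_cut cf (fun w => proj1 (andP (f01 w))) (ltW t0).
apply: (@le_trans _ _ ((lam g)%:E + d%:E)%E).
  by rewrite -EFinD lee_fin (le_trans hcut)// lerD2l.
apply: leeD => //; rewrite sumG -sumEFin.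
apply: (@le_trans _ _ (\sum_(0 <= i < N) inner (U i))%E); last first.
  by apply: nneseries_lim_ge => *; exact: inner_ge0.
rewrite big_mkord; apply: lee_sum => i _; apply: inner_ub; split.
- exact: cont_sub.
- by move=> w; rewrite subr_ge0 GS/=; have := Gg i.+1 w; have := G0 i w; have := g1 w; lra.
- move=> w h; apply: eU; rewrite lt_neqAle e0 andbT; apply/eqP => ei.
  by move: h; rewrite /G SS -ei addr0 subrr ltxx.
Qed.

Let outer0 : outer set0 = 0%E.
Proof.
apply/eqP; rewrite eq_le outer_ge0 andbT outer_open; last exact: open0.
apply: ge_ereal_sup => _ [f [cf f01 f0] <-]; rewrite lee_fin -positive_functional0.
apply: positive_functional_le => //; first exact: cont_cst.
move=> w; have /andP[-> _] /= := f01 w.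
by rewrite leNgt; apply/negP => /f0.
Qed.

Let outer_sigma_subadditive : sigma_subadditive outer.
Proof.
move=> F; apply/lee_addgt0Pr => e e0.
have e2 n : 0 < e / (2 ^ n.+1)%:R by rewrite divr_gt0// ltr0n expn_gt0.
have /choice[U UP] n := outer_adh (F n) (e2 n).
apply: (@le_trans _ _ (\sum_(n <oo) inner (U n))%E).
  have oU : open (\bigcup_n U n) by apply: bigcup_open => n _; case: (UP n).
  apply: (le_trans (outer_le oU _)).
    by apply: subset_bigcup => n _; case: (UP n).
  apply: ge_ereal_sup => _ [f bf <-]; apply: inner_subadditive => // n.
  by case: (UP n).
apply: (@le_trans _ _ (\sum_(n <oo) (outer (F n) + (e / (2 ^ n.+1)%:R)%:E))%E).
  by apply: lee_nneseries => // n _; case: (UP n).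
by apply: epsilon_trick => //; exact: ltW.
Qed.

Let outerM : {outer_measure set T -> \bar R} :=
  HB.pack outer (isOuterMeasure.Build R T outer outer0 outer_ge0 outer_mono
    outer_sigma_subadditive).

(** Take [f] nearly optimal below [V] and [U], then [g] nearly optimal below the part of [V] where
    [f < t], which contains [X] outside [U]. The cut [max (f - t) 0] and [g] are nowhere positive
    together, so their sum is again below [V]. The two choices and the cut cost [d / 3] each. *)
Let open_caratheodory U : open U -> (caratheodory_measurable outerM) U.
Proof.
move=> oU; apply: le_caratheodory_measurable => X /=.
apply: le_ereal_inf_tmp => _ [V [oV XV] <-].
have lam1 : 0 <= lam (fun=> 1) by apply: lam_ge0; [exact: cont_cst|].
apply/lee_addgt0Pr => d d0.
pose t := d / 3 / (lam (fun=> 1) + 1).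
have d3 : 0 < d / 3 by lra.
have t0 : 0 < t by rewrite divr_gt0// ltr_wpDl.
have td : t * lam (fun=> 1) <= d / 3.
  by rewrite /t mulrAC ler_pdivrMr ?ltr_wpDl// ler_wpM2l ?(ltW d3)// lerDl.
have [f [cf f01 fVU] hf] := inner_adh (V `&` U) d3.
pose W := V `&` [set w | f w < t].
have oW : open W by apply: openI => //; exact: open_preim_lt.
have [g [cg g01 gW] hg] := inner_adh W d3.
have hXU : (outer (X `&` U) <= inner (V `&` U))%E.
  by apply: outer_le; [exact: openI|exact: setSI].
have hXW : (outer (X `&` ~` U) <= inner W)%E.
  apply: outer_le => // w [Xw nUw]; split; first exact: XV.
  rewrite /= ltNge; apply/negP => tw.
  by have [_] := fVU w (lt_le_trans t0 tw).
have f0 w : 0 <= f w by case/andP: (f01 w).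
have g0 w : 0 <= g w by case/andP: (g01 w).
pose f' w := Num.max (f w - t) 0.
have cf' : continuous f' by exact: cont_cut.
have f'0 w : 0 <= f' w by rewrite le_max lexx orbT.
have bV : below V (fun w => f' w + g w).
  have alt w : g w = 0 \/ f' w = 0.
    have [gw|] := ltP 0 (g w); last by move=> gw; left; apply/eqP; rewrite eq_le gw g0.
    by right; rewrite /f' max_r// subr_le0 ltW//; case: (gW w gw).
  have f'1 w : f' w <= 1 by rewrite ge_max ler01 andbT; have /andP[_ f1] := f01 w; lra.
  split; first exact: cont_add.
    move=> w; rewrite addr_ge0//=; case: (alt w) => ->; first by rewrite addr0.
    by rewrite add0r; case/andP: (g01 w).
  move=> w; case: (alt w) => ->; rewrite ?addr0 ?add0r => h.
    by move: h; rewrite /f' lt_max ltxx orbF => h; have [|] := fVU w; first by lra.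
  by have [] := gW w h.
have := inner_ub bV; case: hl => _ hD _; rewrite hD// => hV.
have hcut := positive_functional_cut cf f0 (ltW t0).
apply: (le_trans (leeD hXU hXW)); apply: (le_trans (leeD hf hg)).
apply: (@le_trans _ _ ((lam f' + lam g)%:E + d%:E)%E); last by rewrite leeD2r.
by rewrite -!EFinD lee_fin -/f' in hcut *; lra.
Qed.

Let borel_caratheodory (A : set (borelT T)) : measurable A ->
  (measurable : set (set (caratheodory_type outerM))) A.
Proof.
apply: smallest_sub.
  split => //; [by move=> X mX; rewrite setTD; exact: measurableC |
                by move=> u_ mu_; exact: bigcupT_measurable].
by move=> U oU; exact: open_caratheodory.
Qed.

Let outer_semi_sigma_additive : semi_sigma_additive (outer : set (borelT T) -> \bar R).
Proof.
move=> F mF tF mUF.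
apply: (@caratheodory_measure_sigma_additive _ _ outerM F) => //.
- by move=> i; exact: borel_caratheodory.
- exact: borel_caratheodory.
Qed.

Lemma Riesz_measure : exists P : {measure set (borelT T) -> \bar R}, [/\
  (P setT <= (lam (fun=> 1))%:E)%E,
  (forall A (e : R), 0 < e ->
    exists U : set T, [/\ open U, A `<=` U & (P U <= P A + e%:E)%E]),
  (forall (U : set T) f, open U -> below U f -> ((lam f)%:E <= P U)%E) &
  (forall (U : set T) (e : R), open U -> 0 < e ->
    exists2 f, below U f & (P U <= (lam f + e)%:E)%E)].
Proof.
pose P : {measure set (borelT T) -> \bar R} :=
  HB.pack (outer : set (borelT T) -> \bar R)
    (isMeasure.Build _ (borelT T) R (outer : set (borelT T) -> \bar R) outer0 outer_ge0
      outer_semi_sigma_additive).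
exists P; split => /=.
- by rewrite outer_open//; exact: openT.
- move=> A e e0; have [U [oU AU hU]] := outer_adh A e0.
  by exists U; split => //; rewrite /= outer_open.
- by move=> U f oU bf; rewrite outer_open//; exact: inner_ub.
- by move=> U e oU e0; rewrite outer_open//; exact: inner_adh.
Qed.

End Riesz.

Lemma borel_open (R : realType) (T : pseudoPMetricType R) (U : set T) :
  open U -> measurable (U : set (borelT T)).
Proof. by move=> oU; exact: sub_sigma_algebra. Qed.

Lemma borel_continuous (R : realType) (T : pseudoPMetricType R) (f : T -> R) :
  continuous f -> measurable_fun setT (f : borelT T -> R).
Proof.
move=> cf; apply: (measurability _ (RGenOpens.measurableE R)).
move=> _ [_ [a [b ->]] <-]; rewrite setTI.
apply: borel_open; apply: open_comp => // x _; exact: cf.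
Qed.

(** * Integral representation and dominated convergence *)

Section representation.
Variables (R : realType) (T : pseudoPMetricType R).
Hypothesis cT : compact [set: T].

Lemma bounded_integrable (P : {measure set (borelT T) -> \bar R}) (f : borelT T -> R) (b : R) :
  (P setT < +oo)%E -> measurable_fun setT f -> (forall w, `|f w| <= b) ->
  P.-integrable setT (EFin \o f).
Proof.
move=> Pfin mf fb; apply: measurable_bounded_integrable => //.
exists b; split; rewrite ?num_real // => x bx w _ /=.
exact: le_trans (fb w) (ltW bx).
Qed.

Lemma continuous_integrable (P : {measure set (borelT T) -> \bar R}) (f : T -> R) :
  (P setT < +oo)%E -> continuous f -> P.-integrable setT (EFin \o (f : borelT T -> R)).
Proof.
move=> Pfin cf; have [b hb] := compact_bounded cT cf.
by apply: (@bounded_integrable P f b) => //; exact: borel_continuous.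
Qed.

Lemma positive_functional_integral (P : {measure set (borelT T) -> \bar R}) :
  (P setT < +oo)%E -> positive_functional (fun f => \int[P]_(w in setT) f w)%R.
Proof.
move=> Pfin; split.
- by move=> f _ f0; apply: Rintegral_ge0.
- by move=> f g cf cg _ _; rewrite RintegralD//; exact: continuous_integrable.
- by move=> a f _ cf _; rewrite RintegralZl//; exact: continuous_integrable.
Qed.

Lemma continuous_integral_fin (P : {measure set (borelT T) -> \bar R}) (f : T -> R) :
  (P setT < +oo)%E -> continuous f ->
  (\int[P]_(w in setT) (f w)%:E = (\int[P]_(w in setT) f w)%:E)%E.
Proof.
move=> Pfin cf; rewrite /Rintegral fineK//.
by apply: integrable_fin_num => //; exact: continuous_integrable.
Qed.

(** Layers give only [lam x <= I x] for [0 <= x <= 1]; the same for [1 - x], together with equality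
    at 1, turns this into an equality, and scaling does the rest. The regularity clauses are kept
    because invariance and ergodicity are proved by approximating Borel sets by open ones. *)
Lemma Riesz_representation (lam : (T -> R) -> R) : positive_functional lam ->
  exists P : {measure set (borelT T) -> \bar R}, [/\
  (P setT = (lam (fun=> 1))%:E)%E,
  (forall f : T -> R, continuous f -> (forall w, 0 <= f w) ->
    (\int[P]_(w in setT) f w)%R = lam f),
  (forall A (e : R), 0 < e ->
    exists U : set T, [/\ open U, A `<=` U & (P U <= P A + e%:E)%E]),
  (forall (U : set T) f, open U -> below U f -> ((lam f)%:E <= P U)%E) &
  (forall (U : set T) (e : R), open U -> 0 < e ->
    exists2 f, below U f & (P U <= (lam f + e)%:E)%E)].
Proof.
move=> hl; have [P [P1 Preg Pub Padh]] := Riesz_measure cT hl.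
have Pfin : (P setT < +oo)%E by rewrite (le_lt_trans P1)// ltry.
have fineP (A : set (borelT T)) : measurable A -> P A = (fine (P A))%:E.
  move=> mA; rewrite fineK// ge0_fin_numE// (le_lt_trans _ Pfin)//.
  by apply: le_measure; rewrite ?inE.
pose I (f : T -> R) := (\int[P]_(w in setT) f w)%R.
have hI : positive_functional I by exact: positive_functional_integral.
have [h0 hD hZ] := hl; have [I0 ID IZ] := hI.
have c1 := @cont_cst R T 1.
have I1 : I (fun=> 1) = fine (P setT) by rewrite /I Rintegral_cst// mul1r.
(* Slice [x] into layers of height [1/n]. *)
have le_I (x : T -> R) : continuous x -> (forall w, 0 <= x w <= 1) -> lam x <= I x.
  move=> cx x01; apply/ler_addgt0Pr => e e0.
  pose n := (Num.truncn (fine (P setT) / e)).+1.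
  have n0 : 0 < n%:R :> R by rewrite ltr0n.
  have hn : fine (P setT) / n%:R <= e.
    rewrite ler_pdivrMr// mulrC -ler_pdivrMr//; exact/ltW/truncnS_gt.
  pose g i w := Num.min (x w) (i%:R / n%:R).
  have cg i : continuous (g i) by apply: cont_min => //; exact: cont_cst.
  pose c i w := g i.+1 w - g i w.
  have cc i : continuous (c i) by exact: cont_sub.
  have stepE i : i.+1%:R / n%:R = i%:R / n%:R + 1 / n%:R :> R.
    by rewrite -addn1 natrD mulrDl.
  have n1 : 0 < 1 / n%:R :> R by rewrite divr_gt0.
  have c01 i w : 0 <= c i w <= 1 / n%:R.
    rewrite /c /g stepE; case: (leP (x w) (i%:R / n%:R + 1 / n%:R)) => h1;
      case: (leP (x w) (i%:R / n%:R)) => h2; lra.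
  have c0 i w : 0 <= c i w by case/andP: (c01 i w).
  have xE w : x w = \sum_(i < n) c i w.
    rewrite -(big_mkord xpredT (fun i => c i w)) telescope_sumr// /g mul0r.
    have /andP[h1 h2] := x01 w.
    by rewrite divff ?gt_eqF// (min_l h2) (min_r h1) subr0.
  have xE' : x = fun w => \sum_(i < n) c i w by apply/funext.
  pose U i := [set w | i%:R / n%:R < x w].
  have oU i : open (U i) by exact: open_preim_gt.
  have nc0 i w : 0 <= n%:R * c i w by rewrite mulr_ge0.
  have lamc i : lam (c i) <= fine (P (U i)) / n%:R.
    rewrite ler_pdivlMr// mulrC -hZ// -lee_fin -fineP; last exact: borel_open.
    apply: Pub => //; split; first exact: cont_scale.
      move=> w; rewrite nc0/=; have /andP[_ h] := c01 i w.
      by rewrite mulrC -ler_pdivlMr.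
    move=> w; rewrite /U/=; apply: contraTT; rewrite -!leNgt => h.
    rewrite /c /g !min_l ?subrr ?mulr0// stepE; lra.
  have Ic i : fine (P (U i.+1)) / n%:R <= I (c i).
    rewrite ler_pdivrMr// mulrC -IZ// -lee_fin -fineP; last exact: borel_open.
    rewrite /I -continuous_integral_fin//; last exact: cont_scale.
    rewrite -[X in P X]setIT -integral_indic//; last exact: borel_open.
    apply: ge0_le_integral => //.
    - by apply/measurable_EFinP; apply: measurable_indic; exact: borel_open.
    - by apply/measurable_EFinP; apply: borel_continuous; exact: cont_scale.
    - move=> w _; rewrite lee_fin indicE; have [|] := boolP (w \in U i.+1); last by rewrite nc0.
      rewrite inE /U /= => h; rewrite /c /g !min_r ?(ltW h)//; last by move: h; rewrite stepE; lra.
      by rewrite stepE addrAC subrr add0r mulrC mul1r mulVf// gt_eqF.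
  (* The upper bound of [lam (c i.+1)] is the lower bound of [I (c i)]. After this shift by one
     level only layer 0 is left over, and it costs at most [P setT / n <= e]. *)
  rewrite xE' (positive_functional_sum hl)// (positive_functional_sum hI)//.
  rewrite /n big_ord_recl/= -/n [X in _ <= X + _]big_ord_recr/= -/n.
  have hU0 : lam (c 0%N) <= e.
    apply: (le_trans (lamc 0%N)); apply: le_trans hn.
    rewrite ler_wpM2r ?invr_ge0 ?(ltW n0)// fine_le//.
    - by rewrite fineP//; exact: borel_open.
    - by rewrite fineP.
    - by apply: le_measure; rewrite ?inE//; exact: borel_open.
  set k := Num.truncn _.
  have hs : \sum_(i < k) lam (c (bump 0 i)) <= \sum_(i < k) I (c i).
    by apply: ler_sum => i _; exact: le_trans (lamc _) (Ic _).
  have hk : 0 <= I (c k) by exact: I0.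
  by move: hU0 hs hk; lra.
have P1E : P setT = (lam (fun=> 1))%:E.
  apply/eqP; rewrite eq_le P1/= fineP// lee_fin -I1; apply: le_I => // w.
  by rewrite ler01 lexx.
have lamI1 : lam (fun=> 1) = I (fun=> 1) by rewrite I1 P1E.
have eq01 (x : T -> R) : continuous x -> (forall w, 0 <= x w <= 1) -> I x = lam x.
  move=> cx x01; apply/eqP; rewrite eq_le le_I// andbT.
  have cy : continuous (fun w => 1 - x w) by exact: cont_sub.
  have y01 w : 0 <= 1 - x w <= 1 by have := x01 w; lra.
  have := le_I _ cy y01.
  have x0 w : 0 <= x w by case/andP: (x01 w).
  have y0 w : 0 <= 1 - x w by case/andP: (y01 w).
  have := hD _ _ cx cy x0 y0; have := ID _ _ cx cy x0 y0.
  have -> : (fun w => x w + (1 - x w)) = fun=> 1 by apply/funext => w; rewrite subrKC.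
  by rewrite lamI1; lra.
exists P; split => // f cf f0; rewrite -/(I f).
have [b hb] := compact_bounded cT cf.
have b1 : 0 < `|b| + 1 by rewrite ltr_wpDl.
pose y w := (`|b| + 1)^-1 * f w.
have cy : continuous y by exact: cont_scale.
have y01 w : 0 <= y w <= 1.
  rewrite /y mulr_ge0 ?invr_ge0 ?(ltW b1)//= mulrC ler_pdivrMr// mul1r.
  by have := hb w; have := ler_norm (f w); have := ler_norm b; lra.
have fE : f = fun w => (`|b| + 1) * y w.
  by apply/funext => w; rewrite /y mulrA divff ?mul1r// gt_eqF.
have y0 w : 0 <= y w by case/andP: (y01 w).
have b0 := ltW b1.
by rewrite fE IZ// hZ// eq01.
Qed.

Lemma functional_dominated_convergence (lam : (T -> R) -> R) (h : nat -> T -> R) (b : R) :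
  positive_functional lam -> (forall n, continuous (h n)) ->
  (forall n w, 0 <= h n w <= b) -> (forall w, h n w @[n --> \oo] --> 0) ->
  lam (h n) @[n --> \oo] --> 0.
Proof.
move=> hl ch hb h0; have [P [P1 PI _ _ _]] := Riesz_representation hl.
have Pfin : (P setT < +oo)%E by rewrite P1 ltry.
have mh n : measurable_fun setT (fun w : borelT T => (h n w)%:E).
  by apply/measurable_EFinP; exact: borel_continuous.
have m0 : measurable_fun setT (fun _ : borelT T => 0%E : \bar R).
  exact: measurable_cst.
have cvh : {ae P, forall w, setT w -> (h n w)%:E @[n --> \oo] --> 0%E}.
  apply: aeW => w _; apply: cvg_EFin; first exact: nearW.
  exact: h0.
have ib : P.-integrable setT (EFin \o cst b).
  by apply: (@bounded_integrable P (cst b) `|b|).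
have hbb : {ae P, forall w n, setT w -> (`|(h n w)%:E| <= (EFin \o cst b) w)%E}.
  by apply: aeW => w n _; rewrite lee_fin ger0_norm; case/andP: (hb n w).
have [_ _] := dominated_convergence measurableT mh m0 cvh ib hbb.
have -> : (fun n => \int[P]_x (h n x)%:E)%E = (fun n => (lam (h n))%:E).
  apply/funext => n; rewrite continuous_integral_fin// PI// => w.
  by case/andP: (hb n w).
rewrite integral0 => H.
have F : (fine \o (fun n => (lam (h n))%:E)) @ \oo --> (0 : R) by exact: fine_cvg H.
exact: F.
Qed.

End representation.

(** * Bounded functionals *)

Section duality.
Variables (R : realType) (T : pseudoPMetricType R).
Hypothesis cT : compact [set: T].

Lemma dual0 (mu : (T -> R) -> R) : is_dual mu -> mu (fun=> 0) = 0.
Proof.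
move=> [hlin _]; have c0 := @cont_cst R T 0.
have := hlin 1 _ _ c0 c0; rewrite /= mulr0 addr0 mul1r; lra.
Qed.

Lemma dualD (mu : (T -> R) -> R) (x y : T -> R) : is_dual mu ->
  continuous x -> continuous y -> mu (fun w => x w + y w) = mu x + mu y.
Proof.
move=> [hlin _] cx cy; have := hlin 1 _ _ cx cy; rewrite mul1r => <-.
by congr mu; apply/funext => w; rewrite mul1r.
Qed.

Lemma dualZ (mu : (T -> R) -> R) (a : R) (x : T -> R) : is_dual mu ->
  continuous x -> mu (fun w => a * x w) = a * mu x.
Proof.
move=> hm cx; have [hlin _] := hm; have c0 := @cont_cst R T 0.
have := hlin a _ _ cx c0; rewrite (dual0 hm) addr0 => <-.
by congr mu; apply/funext => w; rewrite addr0.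
Qed.

Lemma dualB (mu : (T -> R) -> R) (x y : T -> R) : is_dual mu ->
  continuous x -> continuous y -> mu (fun w => x w - y w) = mu x - mu y.
Proof.
move=> hm cx cy; have cy' : continuous (fun w => (-1) * y w) by exact: cont_scale.
rewrite -[- mu y]mulN1r -dualZ// -dualD//.
by congr mu; apply/funext => w; rewrite mulN1r.
Qed.

Lemma dual_sum (mu : (T -> R) -> R) (n : nat) (c : nat -> R) (x : nat -> T -> R) :
  is_dual mu -> (forall i, continuous (x i)) ->
  mu (fun w => \sum_(i < n) c i * x i w) = \sum_(i < n) c i * mu (x i).
Proof.
move=> hm cx; elim: n => [|n ih].
  rewrite big_ord0 -[RHS](dual0 hm); congr mu.
  by apply/funext => w; rewrite big_ord0.
rewrite big_ord_recr/= -ih -dualZ// -dualD//.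
- by congr mu; apply/funext => w; rewrite big_ord_recr.
- by apply: (@cont_sum _ _ n (fun i w => c i * x i w)) => i; exact: cont_scale.
- exact: cont_scale.
Qed.

(* [lam] is the total variation of [mu]. *)
Lemma dual_majorant (mu : (T -> R) -> R) : is_dual mu ->
  exists2 lam, positive_functional lam &
    forall f : T -> R, continuous f -> `|mu f| <= lam (fun w => `|f w|).
Proof.
move=> hm; have [_ [M hM]] := hm.
pose S (h : T -> R) := [set mu g | g in [set g : T -> R | continuous g /\ forall w, `|g w| <= h w]].
pose lam h := sup (S h).
have inS h g : continuous g -> (forall w, `|g w| <= h w) -> S h (mu g) by move=> cg gh; exists g.
have c0 := @cont_cst R T 0.
have S0 (h : T -> R) : (forall w, 0 <= h w) -> S h 0.
  by move=> h0; rewrite -(dual0 hm); apply: inS => // w; rewrite normr0.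
have Sub (h : T -> R) : continuous h -> has_ubound (S h).
  move=> ch; have [b hb] := compact_bounded cT ch.
  exists (M * b) => _ [g [cg gh] <-]; apply: (le_trans (ler_norm _)); apply: hM => // w.
  exact: le_trans (gh w) (ler_normlW (hb w)).
have le_lam (h g : T -> R) : continuous h -> continuous g -> (forall w, `|g w| <= h w) -> mu g <= lam h.
  by move=> ch cg gh; apply: ub_le_sup; [exact: Sub|exact: inS].
have ge_lam (h : T -> R) (l : R) : (forall w, 0 <= h w) ->
    (forall g : T -> R, continuous g -> (forall w, `|g w| <= h w) -> mu g <= l) -> lam h <= l.
  by move=> h0 hl; apply: ge_sup; [exists 0; exact: S0|move=> _ [g [cg gh] <-]; exact: hl].
exists lam; last first.
  move=> f cf; have cnf : continuous (fun w => `|f w|) by exact: cont_norm.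
  rewrite ler_norml le_lam ?andbT//.
  rewrite lerNl -mulN1r -dualZ// le_lam//; first exact: cont_scale.
  by move=> w; rewrite mulN1r normrN.
have lamD (h k : T -> R) : continuous h -> continuous k -> (forall w, 0 <= h w) ->
    (forall w, 0 <= k w) -> lam (fun w => h w + k w) = lam h + lam k.
  move=> ch ck h0 k0.
  have chk : continuous (fun w => h w + k w) by exact: cont_add.
  apply/eqP; rewrite eq_le; apply/andP; split.
  - apply: (ge_lam _ _) => [w|g cg gh]; first by rewrite addr_ge0.
    have cNh : continuous (fun w => - h w) by move=> x; apply: cvgN; exact: ch.
    (* The truncation of [g] to [[-h, h]]: since [g] is bounded by [h + k], the remainder [g - g1]
       is bounded by [k]. *)
    pose g1 w := Num.max (Num.min (g w) (h w)) (- h w).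
    have cg1 : continuous g1 by apply: cont_max => //; exact: cont_min.
    have cg2 : continuous (fun w => g w - g1 w) by exact: cont_sub.
    have -> : g = fun w => g1 w + (g w - g1 w) by apply/funext => w; rewrite subrKC.
    rewrite dualD//; apply: lerD; apply: le_lam => // w.
    + rewrite ler_norml; move: (h0 w); rewrite /g1.
      by case: (leP (g w) (h w)) => ?; [case: (leP (g w) (- h w)) => ?|case: (leP (h w) (- h w)) => ?]; lra.
    + rewrite ler_norml; move: (h0 w) (k0 w) (gh w); rewrite ler_norml /g1.
      by case: (leP (g w) (h w)) => ?; [case: (leP (g w) (- h w)) => ?|case: (leP (h w) (- h w)) => ?]; lra.
  - rewrite -lerBrDr; apply: (ge_lam _ _) => // g cg gh.
    rewrite lerBrDl -lerBrDr; apply: (ge_lam _ _) => // g' cg' gk.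
    rewrite lerBrDr -dualD// le_lam//; first exact: cont_add.
    by move=> w; rewrite (le_trans (ler_normD _ _))// addrC lerD.
split => //.
- move=> f cf f0; rewrite -(dual0 hm); apply: le_lam => // w.
  by rewrite normr0.
- move=> a f a0 cf f0.
  have caf : continuous (fun w => a * f w) by exact: cont_scale.
  move: a0; rewrite le_eqVlt => /predU1P[<-|a0].
    rewrite mul0r; apply/eqP; rewrite eq_le; apply/andP; split.
      apply: (ge_lam _ _) => [w|g cg gh]; first by rewrite mul0r.
      rewrite (_ : g = fun=> 0) ?dual0//; apply/funext => w; apply/eqP.
      by rewrite -normr_le0 (le_trans (gh w))// mul0r.
    rewrite -{1}(dual0 hm); apply: le_lam => //; first exact: cont_scale.
    by move=> w; rewrite normr0 mul0r.
  have a0' := ltW a0.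
  (* One inequality suffices: used for [a] and for its inverse it gives both directions. *)
  have lamZ (c : R) (k : T -> R) : 0 < c -> continuous k -> (forall w, 0 <= k w) ->
      c * lam k <= lam (fun w => c * k w).
    move=> cp ck k0; rewrite mulrC -ler_pdivlMr//; apply: (ge_lam _ _) => // g cg gk.
    rewrite ler_pdivlMr// mulrC -dualZ//; apply: le_lam.
    - exact: cont_scale.
    - exact: cont_scale.
    - by move=> w; rewrite normrM (gtr0_norm cp) ler_wpM2l// ltW.
  apply/eqP; rewrite eq_le lamZ// andbT.
  have ai : 0 < a^-1 by rewrite invr_gt0.
  have := lamZ a^-1 _ ai caf; rewrite (_ : (fun w => a^-1 * (a * f w)) = f); last first.
    by apply/funext => w; rewrite mulrA mulVf ?mul1r// gt_eqF.
  by rewrite mulrC ler_pdivrMr// mulrC; apply => w; rewrite mulr_ge0.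
Qed.

Lemma dual_cvg0 (mu : (T -> R) -> R) (u : nat -> T -> R) (b : R) : is_dual mu ->
  (forall n, continuous (u n)) -> (forall n w, `|u n w| <= b) ->
  (forall w, u n w @[n --> \oo] --> 0) -> mu (u n) @[n --> \oo] --> 0.
Proof.
move=> hm cu ub u0; have [lam hl mul] := dual_majorant hm.
have := @functional_dominated_convergence _ _ cT lam (fun n w => `|u n w|) b hl _ _ _.
move=> H; apply/norm_cvg0P; apply: (@squeeze_cvgr _ _ _ _ (fun=> 0) (fun n => lam (fun w => `|u n w|))).
- by apply: nearW => n; rewrite normr_ge0 mul.
- exact: cvg_cst.
- apply: H.
  + by move=> n; exact: cont_norm.
  + by move=> n w; rewrite normr_ge0 ub.
  + by move=> w; apply/norm_cvg0P; exact: u0.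
Qed.

(** The limit [F] may be discontinuous, where [mu] carries no information, so there is no candidate
    for the limit and the Cauchy criterion is used. If it failed, the differences along the
    offending pairs would tend to 0 pointwise, against [dual_cvg0]. *)
Lemma dual_cvg (mu : (T -> R) -> R) (u : nat -> T -> R) (F : T -> R) (b : R) : is_dual mu ->
  (forall n, continuous (u n)) -> (forall n w, `|u n w| <= b) ->
  (forall w, u n w @[n --> \oo] --> F w) -> cvg (mu (u n) @[n --> \oo]).
Proof.
move=> hm cu ub uF; apply/cauchy_cvgP/cauchy_ballP => e e0.
have [N hN] : exists N, forall n m, (N <= n)%N -> (N <= m)%N -> `|mu (u n) - mu (u m)| < e.
  apply: contrapT => hno.
  have /choice[p hp] N : exists p : nat * nat, [/\ (N <= p.1)%N, (N <= p.2)%N &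
      e <= `|mu (u p.1) - mu (u p.2)|].
    apply: contrapT => h; apply: hno; exists N => n m Nn Nm; rewrite ltNge.
    by apply/negP => h'; apply: h; exists (n, m).
  pose v N w := u (p N).1 w - u (p N).2 w.
  have cp1 : (fun N => (p N).1) @ \oo --> \oo.
    by move=> A [n _ nA]; exists n => // k /= nk; apply: nA; case: (hp k) => h _ _; exact: leq_trans h.
  have cp2 : (fun N => (p N).2) @ \oo --> \oo.
    by move=> A [n _ nA]; exists n => // k /= nk; apply: nA; case: (hp k) => _ h _; exact: leq_trans h.
  have : mu (v n) @[n --> \oo] --> 0.
    apply: (@dual_cvg0 _ _ (b + b)) => //.
    - by move=> n; exact: cont_sub.
    - by move=> n w; rewrite (le_trans (ler_normB _ _))// lerD.
    - move=> w; rewrite -(subrr (F w)); apply: cvgB.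
        exact: (cvg_comp _ _ cp1 (uF w)).
      exact: (cvg_comp _ _ cp2 (uF w)).
  move/cvgr0Pnorm_lt => /(_ _ e0)[n _ /(_ n (leqnn n))].
  by rewrite /v dualB//; case: (hp n) => _ _ h; rewrite ltNge h.
exists ((fun n => mu (u n)) @` [set n | (N <= n)%N], (fun n => mu (u n)) @` [set n | (N <= n)%N]) => /=.
  by split; exists N => // n /= Nn; exists n.
by move=> [_ _] [[n Nn <-] [m Nm <-]]; rewrite /ball/=; exact: hN.
Qed.

End duality.

(** * Convex hulls of tame families *)

Section sequential_limits.
Variables (R : realType) (T : topologicalType) (I : Type) (q : set_system I).
Variables (g : nat -> I -> T -> R) (b : nat -> R) (lt : I -> I -> Prop).
Hypothesis qU : UltraFilter q.
Hypothesis gb : forall l i w, `|g l i w| <= b l.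
Hypothesis qlt : forall i, q (lt i).
Hypothesis cover : forall l (e : R), 0 < e ->
  exists M : nat -> set I, (forall n, q (M n)) /\
    forall w, exists n, forall i j, M n i -> M n j -> `|g l i w - g l j w| <= e.

(** [K N] intersects finitely many of the countably many sets [M (l, m) n]. Given [l], [w] and the
    tolerance [1 / (m + 1)], the cover supplies an [n] depending on [w]; for large [N] the index
    [i N] lies in [M (l, m) n], as does some [j] whose value at [w] is close to the ultralimit. *)
Lemma ultralimit_sequence : exists i : nat -> I, (forall n, lt (i n) (i n.+1)) /\
  forall l w, g l (i n) w @[n --> \oo] --> ulim q (fun k => g l k w).
Proof.
have /choice[M MP] (lm : nat * nat) := cover lm.1 (e := lm.2.+1%:R^-1) ltac:(by []).
pose K N := [set i | forall l m n : 'I_N.+1, M (nat_of_ord l, nat_of_ord m) n i].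
have qK N : q (K N).
  apply: (@filter_forall _ _ _ q) => l; apply: (@filter_forall _ _ _ q) => m.
  by apply: (@filter_forall _ _ _ q) => n; have [+ _] := MP (nat_of_ord l, nat_of_ord m); exact.
have /choice[f fP] (p : I * nat) : exists i, lt p.1 i /\ K p.2 i.
  by have [i [h1 h2]] := filter_ex (filterI (qlt p.1) (qK p.2)); exists i.
have [i0 Ki0] := filter_ex (qK 0%N).
pose i := fix i n := if n is m.+1 then f (i m, m.+1) else i0.
have Ki n : K n (i n) by case: n => [//|n] /=; have [] := fP (i n, n.+1).
exists i; split; first by move=> n; have [] := fP (i n, n.+1).
move=> l w; apply/cvgrPdist_le => e e0.
have e2 : 0 < e / 2 by lra.
pose m := Num.truncn (e / 2)^-1.
have hm : m.+1%:R^-1 <= e / 2.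
  rewrite -[leRHS]invrK lef_pV2 ?posrE ?invr_gt0// ltW//; exact: truncnS_gt.
have [qM /(_ w)[n hn]] := MP (l, m).
exists (maxn l (maxn m n)) => // N /=; rewrite !geq_max => /and3P[lN mN nN].
have iM : M (l, m) n (i N).
  have := Ki N (Ordinal (lN : l < N.+1)%N) (Ordinal (mN : m < N.+1)%N) (Ordinal (nN : n < N.+1)%N).
  exact.
have ub : ubounded q (fun k => g l k w) by apply: (@ubounded_all _ _ _ _ _ (b l)).
have [j [Mj /= hj]] := filter_ex (filterI (qM n) (ulimP qU ub e2)).
have h3 : `|g l (i N) w - g l j w| <= e / 2 := le_trans (hn _ _ iM Mj) hm.
by move: hj h3; rewrite !ler_norml; lra.
Qed.

End sequential_limits.

Section positive_functional_bounds.
Variables (R : realType) (T : pseudoPMetricType R) (lam : (T -> R) -> R).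
Hypothesis hl : positive_functional lam.

Lemma positive_functional_norm_sum n (c : nat -> R) (x : nat -> T -> R) (d : R) :
  (forall k, continuous (x k)) ->
  (forall k, (k < n)%N -> lam (fun w => `|x k w|) <= d) ->
  lam (fun w => `|\sum_(k < n) c k * x k w|) <= (\sum_(k < n) `|c k|) * d.
Proof.
move=> cx hd; have [h0 hD hZ] := hl.
have cnx k : continuous (fun w => `|x k w|) by exact: cont_norm.
have ccx k : continuous (fun w => `|c k| * `|x k w|) by exact: cont_scale.
apply: (@le_trans _ _ (lam (fun w => \sum_(k < n) `|c k| * `|x k w|))).
  apply: positive_functional_le => //.
  - apply: cont_norm; apply: (@cont_sum _ _ n (fun k w => c k * x k w)) => k.
    exact: cont_scale.
  - exact: (@cont_sum _ _ n (fun k w => `|c k| * `|x k w|)).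
  - move=> w; rewrite normr_ge0/= (le_trans (ler_norm_sum _ _ _))//.
    by apply: ler_sum => k _; rewrite normrM.
rewrite (positive_functional_sum hl n (f := fun k w => `|c k| * `|x k w|))//.
rewrite mulr_suml; apply: ler_sum => k _; rewrite hZ//.
by rewrite ler_wpM2l// hd.
Qed.

Lemma positive_functional_normD (x y : T -> R) : continuous x -> continuous y ->
  lam (fun w => `|x w + y w|) <= lam (fun w => `|x w|) + lam (fun w => `|y w|).
Proof.
move=> cx cy; have [_ hD _] := hl.
have cnx := cont_norm cx; have cny := cont_norm cy.
rewrite -hD//; apply: positive_functional_le => //.
- by apply: cont_norm; exact: cont_add.
- exact: cont_add.
- by move=> w; rewrite normr_ge0 ler_normD.
Qed.

End positive_functional_bounds.

Section convex_hull.
Variables (R : realType) (T : pseudoPMetricType R) (f : nat -> T -> R) (b : R).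
Hypothesis cT : compact [set: T].
Hypothesis cf : forall k, continuous (f k).
Hypothesis fb : forall k w, `|f k w| <= b.
Hypothesis noind : forall (r s : R) (nk : nat -> nat), r < s ->
  (forall n, (nk n < nk n.+1)%N) -> ~ independent (fun n => f (nk n)) r s.

Lemma increasing_lt (nk : nat -> nat) : (forall n, (nk n < nk n.+1)%N) ->
  forall m n, (m < n)%N -> (nk m < nk n)%N.
Proof.
move=> h m; elim=> // n ih; rewrite ltnS leq_eqVlt => /predU1P[->//|mn].
exact: ltn_trans (ih mn) (h n).
Qed.

(** This half of Rosenthal's dichotomy is the covering argument over a nonprincipal ultrafilter on
    [nat], with [<] for [lt] so that the selected indices increase. *)
Lemma convergent_subsequence (nk : nat -> nat) : (forall n, (nk n < nk n.+1)%N) ->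
  exists i : nat -> nat, (forall n, (i n < i n.+1)%N) /\
    exists F : T -> R, forall w, f (nk (i n)) w @[n --> \oo] --> F w.
Proof.
move=> hnk; have [q [qU qlt]] := nonprincipal_ultra.
have [i [hi iF]] := @ultralimit_sequence R T nat q (fun _ k => f (nk k)) (fun=> b)
   (fun i j => (i < j)%N) qU (fun _ k => @fb (nk k)) qlt
   (fun _ e => @countable_cover R T nat q (fun k => f (nk k)) b
      (fun i j => (i < j)%N) qU (fun k => @cf (nk k)) (fun k => @fb (nk k)) qlt
      (fun r s i rs hi => @noind r s (fun n => nk (i n)) rs
        (fun n => increasing_lt hnk (hi n))) e (compact_second_countable cT)).
by exists i; split => //; exists (fun w => ulim q (fun k => f (nk k) w)); exact: iF 0%N.
Qed.

(** Otherwise some subsequence is [e]-separated in L1; a pointwise convergent subsequence of it has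
    consecutive differences tending to 0 in L1 by dominated convergence. *)
Lemma totally_bounded (lam : (T -> R) -> R) (e : R) : positive_functional lam -> 0 < e ->
  exists K, forall k, exists2 j, (j < K)%N & lam (fun w => `|f k w - f j w|) <= e.
Proof.
move=> hl e0; apply: contrapT => hno.
have /choice[h hP] K : exists k, forall j, (j < K)%N -> e < lam (fun w => `|f k w - f j w|).
  apply: contrapT => H; apply: hno; exists K => k; apply: contrapT => H'.
  apply: H; exists k => j jK; rewrite ltNge; apply/negP => hj.
  by apply: H'; exists j.
have hK K : (K <= h K)%N.
  rewrite leqNgt; apply/negP => /hP.
  rewrite (_ : (fun w => _) = fun=> 0); last by apply/funext => w; rewrite subrr normr0.
  by rewrite positive_functional0// => /(lt_trans e0); rewrite ltxx.
(* [h K] is far from all indices below [K], so the successor in [(nk m).+1] is what separates the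
   new term from [nk m] itself. *)
pose nk := fix nk n := if n is m.+1 then h (nk m).+1 else h 0%N.
have hnk n : (nk n < nk n.+1)%N by exact: hK.
have [i [hi [F iF]]] := convergent_subsequence hnk.
have : lam (fun w => `|f (nk (i n.+1)) w - f (nk (i n)) w|) @[n --> \oo] --> 0.
  apply: (@functional_dominated_convergence _ _ cT _ _ (b + b)) => //.
  - by move=> n; apply: cont_norm; exact: cont_sub.
  - by move=> n w; rewrite normr_ge0/= (le_trans (ler_normB _ _))// lerD.
  - move=> w; apply/norm_cvg0P; rewrite -(subrr (F w)); apply: cvgB => //.
    by have := iF w; rewrite -cvg_shiftS.
move/cvgr0Pnorm_le => /(_ _ e0)[n _ /(_ n (leqnn n))] /=.
move=> /(le_trans (ler_norm _)); apply/negP; rewrite -ltNge.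
have := hi n; case: (i n.+1) => [//|m]; rewrite ltnS => im; apply: hP.
rewrite ltnS; move: im; rewrite leq_eqVlt => /predU1P[->//|im].
exact/ltnW/(increasing_lt hnk).
Qed.

(* An independent sequence of convex combinations is [(s - r)/2]-separated in L1
   of a limit of Bernoulli measures on its independence tree, whereas the [f k]
   are totally bounded there. *)
Lemma convex_hull_not_independent (c : nat -> nat -> R) (N : nat -> nat) (r s : R) :
  r < s -> convex_weights c N ->
  ~ independent (fun n w => \sum_(k < N n) c n k * f k w) r s.
Proof.
move=> rs hc; set g := fun n w => _ => hind.
have cg n : continuous (g n).
  by apply: (@cont_sum _ _ (N n) (fun k w => c n k * f k w)) => k; exact: cont_scale.
have /choice[W hW] (p : nat * (nat -> bool)) : exists w, forall j, (j < p.1)%N ->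
    if p.2 j then s < g j w else g j w < r by exact: hind.
pose ext n (t : {ffun 'I_n -> bool}) (j : nat) := if insub j is Some i then t i else false.
have extE n (t : {ffun 'I_n -> bool}) (i : 'I_n) : ext n t i = t i by rewrite /ext valK.
pose pt n t := W (n, ext n t).
pose avg n (h : T -> R) := (2 ^+ n)^-1 * \sum_(t : {ffun 'I_n -> bool}) h (pt n t).
have p2 n : 0 < 2 ^+ n :> R by rewrite exprn_gt0.
have card2 n : (\sum_(t : {ffun 'I_n -> bool}) 1 : R) = 2 ^+ n.
  by rewrite sumr_const card_ffun card_bool card_ord -natrX.
have [q [qU qlt]] := nonprincipal_ultra.
pose lam h := ulim q (fun n => avg n h).
have avg_le n (h k : T -> R) : (forall w, h w <= k w) -> avg n h <= avg n k.
  by move=> hk; rewrite ler_wpM2l ?invr_ge0 ?(ltW (p2 n))//; apply: ler_sum => t _; exact: hk.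
have avg_cst n (a : R) : avg n (fun=> a) = a.
  rewrite /avg -[X in X = _]mulr1 -[1 in X in _ * X]/(1 : R).
  rewrite (eq_bigr (fun=> a * 1)); last by move=> t _; rewrite mulr1.
  by rewrite -mulr_sumr card2 mulr1 mulrCA mulVf ?mulr1// gt_eqF.
have avgb (h : T -> R) : continuous h -> ubounded q (fun n => avg n h).
  move=> ch; have [B hB] := compact_bounded cT ch.
  apply: (@ubounded_all _ _ _ _ _ B) => n; rewrite ler_norml -{1}(avg_cst n (- B)) -{2}(avg_cst n B).
  by rewrite !avg_le// => w; have := hB w; rewrite ler_norml => /andP[].
have hl : positive_functional lam.
  split.
  - move=> h ch h0; rewrite -(ulim_cst qU 0); apply: ulim_le => //.
    + exact: ubounded_cst.
    + exact: avgb.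
    + by apply: filterS filterT => n _ /=; rewrite -(avg_cst n 0); exact: avg_le.
  - move=> h k ch ck _ _; rewrite /lam -ulimD//; try exact: avgb.
    by congr ulim; apply/funext => n; rewrite /avg big_split mulrDr.
  - move=> a h _ ch _; rewrite /lam -ulimZ//; last exact: avgb.
    by congr ulim; apply/funext => n; rewrite /avg -mulr_sumr mulrCA.
have sep i j : (i < j)%N -> (s - r) / 2 <= lam (fun w => `|g i w - g j w|).
  move=> ij; rewrite -(ulim_cst qU ((s - r) / 2)); apply: ulim_le => //.
  - exact: ubounded_cst.
  - by apply: avgb; apply: cont_norm; exact: cont_sub.
  apply: filterS (qlt j) => n /= jn.
  pose oi := Ordinal (ltn_trans ij jn); pose oj := Ordinal jn.
  pose A (t : {ffun 'I_n -> bool}) : R := `|g i (pt n t) - g j (pt n t)|.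
  (* Flipping bit [i] pairs the patterns. In each pair exactly one pattern has different bits at [i]
     and [j], and there [g i] and [g j] differ by at least [s - r]; hence the average
     [(s - r) / 2]. *)
  pose flip (t : {ffun 'I_n -> bool}) := [ffun x => t x (+) (x == oi)].
  have flipK : involutive flip.
    by move=> t; apply/ffunP => x; rewrite !ffunE -addbA addbb addbF.
  have A0 t : 0 <= A t by exact: normr_ge0.
  have Adiff (t : {ffun 'I_n -> bool}) : t oi != t oj -> s - r <= A t.
    move=> tij; rewrite /A.
    have hi := hW (n, ext n t) i (ltn_trans ij jn).
    have hj := hW (n, ext n t) j jn.
    rewrite /= (@extE n t oi) in hi; rewrite /= (@extE n t oj) in hj.
    move: tij hi hj; rewrite -/(pt n t); case: (t oi); case: (t oj) => // _ hi hj.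
      by rewrite (le_trans _ (ler_norm _))//; lra.
    by rewrite distrC (le_trans _ (ler_norm _))//; lra.
  have AA (t : {ffun 'I_n -> bool}) : s - r <= A t + A (flip t).
    have [tij|tij] := boolP (t oi != t oj); first by rewrite (le_trans (Adiff t tij))// lerDl.
    rewrite (le_trans (Adiff (flip t) _)) ?lerDr//.
    rewrite !ffunE eqxx (_ : oj == oi = false) ?addbF; last first.
      by apply/negbTE; rewrite -val_eqE/= gtn_eqF.
    by move: tij; rewrite negbK => /eqP ->; case: (t oj).
  have S1 : \sum_t (A t + A (flip t)) = 2 * \sum_t A t.
    rewrite big_split/= mulr_natl mulr2n; congr (_ + _).
    by rewrite [RHS](reindex_inj (inv_inj flipK)).
  rewrite /avg -/A ler_pdivlMl//.
  have : \sum_(t : {ffun 'I_n -> bool}) (s - r) <= \sum_t (A t + A (flip t)) by apply: ler_sum.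
  rewrite S1 (eq_bigr (fun=> (s - r) * 1)); last by move=> t _; rewrite mulr1.
  by rewrite -mulr_sumr card2; lra.
(* Three errors of size [e] will be added, and [3 * e] is below the separation
   [(s - r) / 2 = 8 * e]. *)
pose e := (s - r) / 16.
have e0 : 0 < e by rewrite /e; lra.
have [K [j jP]] : exists K, exists j : nat -> nat, forall k, (j k < K)%N /\
    lam (fun w => `|f k w - f (j k) w|) <= e.
  have [K hK] := totally_bounded hl e0; exists K.
  have /choice[j jP] k : exists j, (j < K)%N /\ lam (fun w => `|f k w - f j w|) <= e.
    by have [j h1 h2] := hK k; exists j.
  by exists j.
(* Moving the weight of each [f k] to its neighbour [f (j k)] yields combinations [g' i] of the
   fixed functions [f l], [l < K]. Their bounded coefficient vectors converge along [q], so two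
   indices have nearly equal vectors. *)
pose d i l := \sum_(k < N i | j k == l) c i k.
pose g' i w := \sum_(l < K) d i l * f l w.
have c0 i k : 0 <= c i k by case: (hc i).
have c1 i : \sum_(k < N i) c i k = 1 by case: (hc i).
have cg' i : continuous (g' i).
  by apply: (@cont_sum _ _ K (fun l w => d i l * f l w)) => l; exact: cont_scale.
have g'E i w : g' i w = \sum_(k < N i) c i k * f (j k) w.
  rewrite /g'; under eq_bigr do rewrite /d mulr_suml big_mkcond.
  rewrite exchange_big/=; apply: eq_bigr => k _.
  have [jK _] := jP k.
  rewrite (bigD1 (Ordinal jK))//= eqxx big1 ?addr0// => l.
  rewrite -val_eqE/= => lj; case: eqP => // jl.
  by rewrite jl eqxx in lj.
have gg' i : lam (fun w => `|g i w - g' i w|) <= e.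
  have -> : (fun w => `|g i w - g' i w|) =
      (fun w => `|\sum_(k < N i) c i k * (f k w - f (j k) w)|).
    apply/funext => w; rewrite g'E -sumrB; congr (`| _ |).
    by apply: eq_bigr => k _; rewrite mulrBr.
  apply: (le_trans (@positive_functional_norm_sum _ _ _ hl _ _
    (fun k w => f k w - f (j k) w) e _ _)).
  - by move=> k; exact: cont_sub.
  - by move=> k _; case: (jP k).
  - rewrite (eq_bigr (fun k : 'I_(N i) => c i k)) ?c1 ?mul1r// => k _; exact: ger0_norm.
pose B := lam (fun=> `|b|) + 1.
have B0 : 0 < B.
  rewrite ltr_wpDl//; case: hl => h0 _ _; apply: h0 => //; exact: cont_cst.
have lamf k : lam (fun w => `|f k w|) <= B.
  apply: (@le_trans _ _ (lam (fun=> `|b|))); last by rewrite /B lerDl.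
  apply: positive_functional_le => //; first exact: cont_norm.
    exact: cont_cst.
  by move=> w; rewrite normr_ge0/= (le_trans (fb _ _))// ler_norm.
have d01 i l : `|d i l| <= 1.
  rewrite ger0_norm; last by apply: sumr_ge0.
  rewrite -(c1 i) /d big_mkcond/=; apply: ler_sum => k _.
  by case: ifP.
(* Chosen so that [K] coefficient gaps of size [2 * dl], times the L1 bound [B], add up to at most
   [e]; [K.+1] avoids a zero denominator. *)
pose dl := e / (2 * B * K.+1%:R).
have dl0 : 0 < dl by rewrite divr_gt0// !mulr_gt0.
have close : q [set i | forall l : 'I_K, `|d i l - ulim q (fun k => d k l)| <= dl].
  apply: (@filter_forall _ _ _ q) => l; apply: (ulimP qU) => //.
  exact: (@ubounded_all _ _ _ _ _ 1).
have [i1 hi1] := filter_ex close.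
have [i2 [hi2 i12]] := filter_ex (filterI close (qlt i1)).
have g'12 : lam (fun w => `|g' i1 w - g' i2 w|) <= e.
  have -> : (fun w => `|g' i1 w - g' i2 w|) =
      (fun w => `|\sum_(l < K) (d i1 l - d i2 l) * f l w|).
    apply/funext => w; rewrite -sumrB; congr (`| _ |).
    by apply: eq_bigr => l _; rewrite mulrBl.
  apply: (le_trans (@positive_functional_norm_sum _ _ _ hl _
    (fun l => d i1 l - d i2 l) f B cf _)); first by move=> k _.
  apply: (@le_trans _ _ ((\sum_(l < K) 2 * dl) * B)).
    rewrite ler_wpM2r ?(ltW B0)//; apply: ler_sum => l _.
    by have := hi1 l; have := hi2 l; rewrite !ler_norml; lra.
  rewrite sumr_const card_ord -[_ *+ K]mulr_natl /dl.
  have K0 : 0 < K.+1%:R :> R by rewrite ltr0n.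
  have -> : K%:R * (2 * (e / (2 * B * K.+1%:R))) * B = e * (K%:R / K.+1%:R) :> R.
    by field; rewrite !gt_eqF.
  by rewrite ler_piMr ?(ltW e0)// ler_pdivrMr// mul1r ler_nat.
have := sep i1 i2 i12.
have h1 : lam (fun w => `|g i1 w - g i2 w|) <= e + (e + e).
  have -> : (fun w => `|g i1 w - g i2 w|) = (fun w => `|(g i1 w - g' i1 w) +
      ((g' i1 w - g' i2 w) + (g' i2 w - g i2 w))|).
    by apply/funext => w; congr (`| _ |); ring.
  have k1 : continuous (fun w => g i1 w - g' i1 w) by exact: cont_sub.
  have k2 : continuous (fun w => g' i1 w - g' i2 w) by exact: cont_sub.
  have k3 : continuous (fun w => g' i2 w - g i2 w) by exact: cont_sub.
  have k23 := cont_add k2 k3.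
  apply: (le_trans (positive_functional_normD hl k1 k23)); apply: lerD => //.
  apply: (le_trans (positive_functional_normD hl k2 k3)); apply: lerD => //.
  have -> : (fun w => `|g' i2 w - g i2 w|) = (fun w => `|g i2 w - g' i2 w|).
    by apply/funext => w; rewrite distrC.
  exact: gg'.
by move: h1; rewrite /e; lra.
Qed.

End convex_hull.

(** * Extreme invariant means *)

Section invariant_means.
Variable R : realType.
Implicit Types (f g : nat -> R) (m : (nat -> R) -> R) (F : set ((nat -> R) -> R)).

Definition bounded_seq f := exists b : R, forall k, `|f k| <= b.

(* The value at unbounded sequences is normalised to [0], so that invariant means
   form a set closed under ultralimits and equality of means is extensional. *)
Record invariant_mean m : Prop := {
  mean_linear : forall (a : R) f g, bounded_seq f -> bounded_seq g ->
    m (fun k => a * f k + g k) = a * m f + m g;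
  mean_norm : forall f (b : R), (forall k, `|f k| <= b) -> `|m f| <= b;
  mean1 : m (fun=> 1) = 1;
  mean_shift : forall f, bounded_seq f -> m (fun k => f k.+1) = m f;
  mean_junk : forall f, ~ bounded_seq f -> m f = 0 }.

Lemma bounded_seq_cst (a : R) : bounded_seq (fun=> a).
Proof. by exists `|a|. Qed.

Lemma bounded_seqD f g : bounded_seq f -> bounded_seq g -> bounded_seq (fun k => f k + g k).
Proof. by move=> [a ha] [b hb]; exists (a + b) => k; rewrite (le_trans (ler_normD _ _))// lerD. Qed.

Lemma bounded_seqM f g : bounded_seq f -> bounded_seq g -> bounded_seq (fun k => f k * g k).
Proof. by move=> [a ha] [b hb]; exists (a * b) => k; rewrite normrM ler_pM. Qed.

Lemma bounded_seqZ (a : R) f : bounded_seq f -> bounded_seq (fun k => a * f k).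
Proof. by apply: bounded_seqM; exact: bounded_seq_cst. Qed.

Lemma bounded_seqB f g : bounded_seq f -> bounded_seq g -> bounded_seq (fun k => f k - g k).
Proof. by move=> [a ha] [b hb]; exists (a + b) => k; rewrite (le_trans (ler_normB _ _))// lerD. Qed.

Lemma bounded_seqS f : bounded_seq f -> bounded_seq (fun k => f k.+1).
Proof. by move=> [b hb]; exists b. Qed.

(** An ultralimit of Cesàro means: a shift changes the average of [n.+1] terms by two boundary terms
    divided by [n.+1]. *)
Lemma exists_invariant_mean : exists m, invariant_mean m.
Proof.
have [q [qU qlt]] := nonprincipal_ultra.
pose C n f := n.+1%:R^-1 * \sum_(k < n.+1) f k.
have n0 n : 0 < n.+1%:R :> R by [].
have Cb n f (b : R) : (forall k, `|f k| <= b) -> `|C n f| <= b.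
  move=> fb; rewrite normrM ger0_norm ?invr_ge0// ler_pdivrMl//.
  rewrite (le_trans (ler_norm_sum _ _ _))// -[n.+1 in leRHS]card_ord mulr_natl -sumr_const.
  by apply: ler_sum => k _; exact: fb.
have Cu f : bounded_seq f -> ubounded q (fun n => C n f).
  by move=> [b fb]; apply: (@ubounded_all _ _ _ _ _ b) => n; exact: Cb.
exists (fun f => if pselect (bounded_seq f) then ulim q (fun n => C n f) else 0).
split.
- move=> a f g bf bg; have bfg := bounded_seqD (bounded_seqZ a bf) bg.
  case: pselect => [?|//] /=; case: pselect => [?|//] /=; case: pselect => [?|//] /=.
  rewrite -ulimZ; last exact: Cu.
  rewrite -ulimD; [|exact/uboundedZ/Cu|exact: Cu].
  congr ulim; apply/funext => n; rewrite /C big_split/= -mulr_sumr; ring.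
- move=> f b fb; case: pselect => [bf|[]] /=; last by exists b.
  by apply: ulim_norm_le; apply: filterS filterT => n _ /=; exact: Cb.
- case: pselect => [?|[]] /=; last exact: bounded_seq_cst.
  rewrite -[RHS](ulim_cst qU); congr ulim; apply/funext => n.
  by rewrite /C sumr_const card_ord mulVf.
- move=> f bf; have bf' := bounded_seqS bf.
  case: pselect => [?|//] /=; case: pselect => [?|//] /=.
  apply: ulimE => // e e0.
  have [b fb] := bf.
  have e2 : 0 < e / 2 by lra.
  have qN : q [set n | `|C n (fun k => f k.+1) - C n f| <= e / 2].
    apply: filterS (qlt (Num.truncn ((b + b) / (e / 2)))) => n /= hn.
    rewrite /C -mulrBr -sumrB normrM ger0_norm ?invr_ge0// ler_pdivrMl//.
    rewrite -(big_mkord xpredT (fun k => f k.+1 - f k)) telescope_sumr//.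
    rewrite (le_trans (ler_normB _ _))// (le_trans (lerD (fb _) (fb _)))//.
    rewrite -ler_pdivrMr// ltW// (lt_le_trans (truncnS_gt _))// ler_nat.
    exact: leqW.
  apply: filterS2 qN (ulimP qU (Cu _ bf) e2) => n /=; rewrite !ler_norml; lra.
- by move=> f nbf; case: pselect.
Qed.

Lemma ulim_invariant_mean (p : set_system ((nat -> R) -> R)) : UltraFilter p ->
  p invariant_mean -> invariant_mean (fun f => ulim p (fun m => m f)).
Proof.
move=> pU pI.
have pb f : bounded_seq f -> ubounded p (fun m => m f).
  by move=> [b fb]; exists b; apply: filterS pI => m /mean_norm; exact.
have eq_ulim (u v : ((nat -> R) -> R) -> R) : ubounded p v -> p [set m | u m = v m] -> ulim p u = ulim p v.
  move=> bv huv; apply: ulimE => e e0.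
  by apply: filterS2 huv (ulimP pU bv e0) => m /= ->.
split.
- move=> a f g bf bg; rewrite -ulimZ; last exact: pb.
  rewrite -ulimD; [|exact/uboundedZ/pb|exact: pb].
  apply: eq_ulim; first by apply: uboundedD; [exact/uboundedZ/pb|exact: pb].
  by apply: filterS pI => m hm /=; rewrite mean_linear.
- move=> f b fb; apply: ulim_norm_le.
  by apply: filterS pI => m hm /=; exact: mean_norm.
- rewrite -[RHS](ulim_cst pU); apply: eq_ulim; first exact: ubounded_cst.
  by apply: filterS pI => m hm /=; exact: mean1.
- move=> f bf; apply: eq_ulim; first exact: pb.
  by apply: filterS pI => m hm /=; exact: mean_shift.
- move=> f bf; rewrite -[RHS](ulim_cst pU); apply: eq_ulim; first exact: ubounded_cst.
  by apply: filterS pI => m hm /=; exact: mean_junk.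
Qed.

(** A nonempty weak-star compact face of the set of invariant means. Compactness is expressed as
    closure under pointwise ultralimits, so no topology on functionals has to be set up. *)
Definition mean_face F := [/\ F `<=` invariant_mean, F !=set0,
  (forall p, UltraFilter p -> p F -> F (fun f => ulim p (fun m => m f))) &
  (forall m m1 m2 (t : R), F m -> invariant_mean m1 -> invariant_mean m2 -> 0 < t < 1 ->
    (forall f, bounded_seq f -> m f = t * m1 f + (1 - t) * m2 f) -> F m1 /\ F m2)].

(** Nonemptiness is the compactness step: an ultrafilter containing every face of the chain has its
    pointwise limit in each of them. *)
Lemma mean_face_bigcap (A : set (set ((nat -> R) -> R))) : A !=set0 ->
  (forall F, A F -> mean_face F) -> (forall F G, A F -> A G -> F `<=` G \/ G `<=` F) ->
  mean_face (\bigcap_(F in A) F).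
Proof.
move=> [F0 AF0] faceA totA; split.
- by move=> m /(_ _ AF0); have [+ _ _ _] := faceA _ AF0; exact.
- pose B := [set X | exists2 F, A F & F `<=` X].
  have BF : ProperFilter B.
    apply: Build_ProperFilter_ex.
      by move=> X [F AF FX]; have [_ [m Fm] _ _] := faceA _ AF; exists m; exact: FX.
    split.
    + by exists F0.
    + move=> X Y [F AF FX] [G AG GY]; have [FG|GF] := totA _ _ AF AG.
        by exists F => // m Fm; split; [exact: FX|exact/GY/FG].
      by exists G => // m Gm; split; [exact/FX/GF|exact: GY].
    + by move=> X Y XY [F AF FX]; exists F => //; exact: subset_trans XY.
  have [p [pU Bp]] := ultraFilterLemma BF.
  exists (fun f => ulim p (fun m => m f)) => F AF.
  by have [_ _ + _] := faceA _ AF; apply => //; apply: Bp; exists F.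
- move=> p pU pA F AF; have [_ _ + _] := faceA _ AF; apply => //.
  by apply: filterS pA => m; exact.
- move=> m m1 m2 t hm h1 h2 t01 hE; split=> F AF; have [_ _ _ /(_ m m1 m2 t)] := faceA _ AF;
    by case=> //; exact: hm.
Qed.

(** [s] is the supremum of [m f] over [F]. It is attained by an ultralimit of near-maximizers, and a
    proper convex combination of two values at most [s] equals [s] only if both values do. *)
Lemma mean_face_argmax F f : mean_face F -> bounded_seq f ->
  exists s : R, mean_face (F `&` [set m | m f = s]).
Proof.
move=> [FI [m0 Fm0] Fcl Ffa] [b fb].
have Fb m : F m -> `|m f| <= b by move=> /FI /mean_norm; exact.
pose S := [set m f | m in F].
have Sub : has_ubound S by exists b => _ [m Fm <-]; exact: ler_normlW (Fb _ Fm).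
have leS m : F m -> m f <= sup S by move=> Fm; apply: ub_le_sup => //; exists m.
exists (sup S).
have pFb p : UltraFilter p -> p F -> ubounded p (fun m => m f).
  by move=> pU pF; exists b; apply: filterS pF => m; exact: Fb.
split.
- by move=> m [/FI].
- pose B := [set X | exists2 e : R, 0 < e & F `&` [set m | sup S - e < m f] `<=` X].
  have BF : ProperFilter B.
    apply: Build_ProperFilter_ex.
      move=> X [e e0 eX]; have [|_ [m Fm <-] hm] := @sup_adherent _ S e e0.
        by split => //; exists (m0 f), m0.
      by exists m; exact: eX.
    split.
    + by exists 1.
    + move=> X Y [e e0 eX] [d d0 dY]; exists (Num.min e d); first by rewrite lt_min e0.
      move=> m [Fm /= hm].
      have m1 : Num.min e d <= e by rewrite ge_min lexx.
      have m2 : Num.min e d <= d by rewrite ge_min lexx orbT.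
      by split; [apply: eX|apply: dY]; split => //=; lra.
    + by move=> X Y XY [e e0 eX]; exists e => //; exact: subset_trans XY.
  have [p [pU Bp]] := ultraFilterLemma BF.
  have pF : p F by apply: Bp; exists 1 => // m [].
  exists (fun f => ulim p (fun m => m f)); split; first exact: Fcl.
  apply: ulimE => // e e0; apply: Bp; exists e => // m [Fm /= hm].
  by have := leS m Fm; rewrite ler_norml; lra.
- move=> p pU pF; split; first by apply: Fcl => //; apply: filterS pF => m [].
  apply: ulimE => // e e0; apply: filterS pF => m [_ /= ->].
  by rewrite subrr normr0 ltW.
- move=> m m1 m2 t [Fm /= ms] h1 h2 t01 hE.
  have [F1 F2] := Ffa _ _ _ _ Fm h1 h2 t01 hE.
  have bf : bounded_seq f by exists b.
  have := hE _ bf; have := leS _ F1; have := leS _ F2; rewrite ms.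
  have /andP[t0 t1] := t01.
  set x := m1 f; set y := m2 f; set s := sup S => ys xs E.
  have tx : t * (s - x) + (1 - t) * (s - y) = 0.
    have -> : t * (s - x) + (1 - t) * (s - y) = s - (t * x + (1 - t) * y) by ring.
    by rewrite -E subrr.
  have h3 : 0 <= t * (s - x) by rewrite mulr_ge0 ?subr_ge0// ltW.
  have h4 : 0 <= (1 - t) * (s - y) by rewrite mulr_ge0 ?subr_ge0// ltW.
  have /eqP : t * (s - x) = 0 by lra.
  have /eqP : (1 - t) * (s - y) = 0 by lra.
  rewrite !mulf_eq0 !subr_eq0 (gt_eqF t0) (gt_eqF t1)/= => /eqP sy /eqP sx.
  by split; split.
Qed.

(** The Krein-Milman argument: a minimal face lies inside each of its subfaces from
    [mean_face_argmax], so every evaluation is constant on it and the face is a single point. *)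
Lemma exists_extreme_invariant_mean : exists2 m, invariant_mean m &
  forall m1 m2 (t : R), invariant_mean m1 -> invariant_mean m2 -> 0 < t < 1 ->
    (forall f, bounded_seq f -> m f = t * m1 f + (1 - t) * m2 f) -> m1 = m.
Proof.
have face0 : mean_face invariant_mean.
  split => //; [exact: exists_invariant_mean|exact: ulim_invariant_mean].
pose faceT := {F | mean_face F}.
(* Reverse inclusion, so that a maximal element is a minimal face. *)
pose sub (F G : faceT) := `[< projT1 G `<=` projT1 F >].
have [|||[F Fface] Fmin] := @ZL_preorder faceT (exist _ _ face0) sub.
- by move=> F; exact/asboolP.
- by move=> F G H /asboolP GF /asboolP HG; apply/asboolP; exact: subset_trans GF.
- move=> A totA; have [[F0 AF0]|A0] := pselect (A !=set0); last first.
    by exists (exist _ _ face0) => F AF; exfalso; apply: A0; exists F.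
  have hA : mean_face (\bigcap_(F in [set projT1 F | F in A]) F).
    apply: mean_face_bigcap.
    + by exists (projT1 F0), F0.
    + by move=> _ [[F hF] _ <-].
    + move=> _ _ [F AF <-] [G AG <-].
      by have [/asboolP|/asboolP] := totA _ _ AF AG; [right|left].
  exists (exist _ _ hA) => F AF; apply/asboolP => m /=; apply; by exists F.
have uniqF m m' : F m -> F m' -> m = m'.
  move=> Fm Fm'; apply/funext => f.
  have [FI _ _ _] := Fface.
  have [bf|nbf] := pselect (bounded_seq f); last first.
    by rewrite (mean_junk (FI _ Fm))// (mean_junk (FI _ Fm')).
  have [s hs] := mean_face_argmax Fface bf.
  have /asboolP FF := Fmin (exist _ _ hs) (asboolT (@subIsetl _ _ _)).
  by have [_ /= ->] := FF _ Fm; have [_ /= ->] := FF _ Fm'.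
have [FI [m Fm] _ Ffa] := Fface.
exists m; first exact: FI.
move=> m1 m2 t h1 h2 t01 hE; have [F1 _] := Ffa _ _ _ _ Fm h1 h2 t01 hE.
exact: uniqF.
Qed.

End invariant_means.

(** * Ergodicity of orbit means *)

Section probability.
Variables (R : realType) (T : pseudoPMetricType R).
Hypothesis cT : compact [set: T].

Lemma Riesz_probability (lam : (T -> R) -> R) : positive_functional lam -> lam (fun=> 1) = 1 ->
  exists P : probability (borelT T) R, [/\
  (forall f : T -> R, continuous f -> (forall w, 0 <= f w) ->
    (\int[P]_(w in setT) f w)%R = lam f),
  (forall A (e : R), 0 < e ->
    exists U : set T, [/\ open U, A `<=` U & (P U <= P A + e%:E)%E]),
  (forall (U : set T) f, open U -> below U f -> ((lam f)%:E <= P U)%E) &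
  (forall (U : set T) (e : R), open U -> 0 < e ->
    exists2 f, below U f & (P U <= (lam f + e)%:E)%E)].
Proof.
move=> hl h1; have [P [P1 PI Preg Pub Padh]] := Riesz_representation cT hl.
have PT : P setT = 1%E by rewrite P1 h1.
pose mP := isMeasure.Build _ (borelT T) R (fun A => P A) (measure0 P) (measure_ge0 P)
  (@measure_semi_sigma_additive _ _ _ P).
pose P2 : {measure set (borelT T) -> \bar R} := HB.pack (fun A : set (borelT T) => P A) mP.
pose P' : probability (borelT T) R := HB.pack (fun A : set (borelT T) => P A) mP
  (Measure_isProbability.Build _ (borelT T) R P2 PT).
by exists P'; split.
Qed.

Variable P : probability (borelT T) R.

Lemma Rintegral_indicator (A : set (borelT T)) : measurable A ->
  (\int[P]_(w in setT) (\1_A w : R))%R = fine (P A).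
Proof. by move=> mA; rewrite /Rintegral integral_indic// setIT. Qed.

Definition bounded_measurable (f : borelT T -> R) :=
  measurable_fun setT f /\ exists b : R, forall w, `|f w| <= b.

Lemma bounded_measurable_continuous (f : T -> R) : continuous f -> bounded_measurable f.
Proof.
by move=> cf; split; [exact: borel_continuous|exact: compact_bounded].
Qed.

Lemma bounded_measurable_indic (A : set (borelT T)) : measurable A -> bounded_measurable (\1_A).
Proof.
move=> mA; split; first exact: measurable_indic.
by exists 1 => w; rewrite indicE; case: (_ \in _); rewrite ?normr1 ?normr0.
Qed.

Lemma bounded_measurableD (f g : borelT T -> R) : bounded_measurable f -> bounded_measurable g ->
  bounded_measurable (fun w => f w + g w).
Proof.
move=> [mf [a fa]] [mg [b gb]]; split; first exact: measurable_funD.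
by exists (a + b) => w; rewrite (le_trans (ler_normD _ _))// lerD.
Qed.

Lemma bounded_measurableB (f g : borelT T -> R) : bounded_measurable f -> bounded_measurable g ->
  bounded_measurable (fun w => f w - g w).
Proof.
move=> [mf [a fa]] [mg [b gb]]; split; first exact: measurable_funB.
by exists (a + b) => w; rewrite (le_trans (ler_normB _ _))// lerD.
Qed.

Lemma bounded_measurable_norm (f : borelT T -> R) : bounded_measurable f ->
  bounded_measurable (fun w => `|f w|).
Proof.
move=> [mf [a fa]]; split; first exact: measurableT_comp.
by exists a => w; rewrite normr_id.
Qed.

Lemma bounded_measurable_integrable (f : borelT T -> R) : bounded_measurable f ->
  P.-integrable setT (EFin \o f).
Proof.
move=> [mf [b fb]]; apply: (@bounded_integrable _ _ P f b) => //.
by rewrite (le_lt_trans (probability_le1 P measurableT))// ltry.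
Qed.

(* [f] and [1_A] both lie below [1_U], so their distance is controlled by the two gaps. *)
Lemma L1_gap (f : borelT T -> R) (A U : set (borelT T)) : bounded_measurable f ->
  measurable A -> measurable U -> A `<=` U -> (forall w, 0 <= f w <= \1_U w) ->
  (\int[P]_(w in setT) `|f w - \1_A w| <=
    fine (P U) - (\int[P]_(w in setT) f w) + (fine (P U) - fine (P A)))%R.
Proof.
move=> bf mA mU AU fU.
have bA := bounded_measurable_indic mA; have bU := bounded_measurable_indic mU.
have bUf := bounded_measurableB bU bf; have bUA := bounded_measurableB bU bA.
rewrite -!Rintegral_indicator// -!RintegralB//; try exact: bounded_measurable_integrable.
rewrite -RintegralD//; try exact: bounded_measurable_integrable.
apply: le_Rintegral => //.
- exact/bounded_measurable_integrable/bounded_measurable_norm/bounded_measurableB.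
- exact/bounded_measurable_integrable/bounded_measurableD.
- move=> w _; have : \1_A w <= \1_U w :> R.
    rewrite !indicE ler_nat; have [Aw|//] := boolP (w \in A).
    by rewrite mem_set//; apply: AU; exact: set_mem.
  by rewrite ler_norml; have := fU w; lra.
Qed.

End probability.

(** * Positivity and linearity of invariant means *)

Section mean_theory.
Variables (R : realType) (m : (nat -> R) -> R).
Hypothesis hm : invariant_mean m.
Implicit Types f g : nat -> R.

Lemma mean_zero : m (fun=> 0) = 0.
Proof. by apply/eqP; rewrite -normr_le0; apply: (mean_norm hm) => k; rewrite normr0. Qed.

Lemma meanD f g : bounded_seq f -> bounded_seq g -> m (fun k => f k + g k) = m f + m g.
Proof.
move=> bf bg; have := mean_linear hm 1 bf bg; rewrite mul1r => <-.
by congr m; apply/funext => k; rewrite mul1r.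
Qed.

Lemma meanZ (a : R) f : bounded_seq f -> m (fun k => a * f k) = a * m f.
Proof.
move=> bf; have := mean_linear hm a bf (bounded_seq_cst 0); rewrite mean_zero addr0 => <-.
by congr m; apply/funext => k; rewrite addr0.
Qed.

Lemma mean_cst (a : R) : m (fun=> a) = a.
Proof.
by have := meanZ a (bounded_seq_cst 1); rewrite (mean1 hm) /= mulr1.
Qed.

Lemma meanB f g : bounded_seq f -> bounded_seq g -> m (fun k => f k - g k) = m f - m g.
Proof.
move=> bf bg; rewrite -[- m g]mulN1r -meanZ// -meanD//; last exact: bounded_seqZ.
by congr m; apply/funext => k; rewrite mulN1r.
Qed.

Lemma mean_ge0 f : bounded_seq f -> (forall k, 0 <= f k) -> 0 <= m f.
Proof.
move=> bf f0; have [b fb] := bf.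
have h k : `|f k - b / 2| <= b / 2 by have := f0 k; have := fb k; rewrite !ler_norml; lra.
have := mean_norm hm h; rewrite meanB ?mean_cst//; last exact: bounded_seq_cst.
by rewrite ler_norml; lra.
Qed.

Lemma mean_le f g : bounded_seq f -> bounded_seq g -> (forall k, f k <= g k) -> m f <= m g.
Proof.
move=> bf bg fg; rewrite -subr_ge0 -meanB//; apply: mean_ge0; first exact: bounded_seqB.
by move=> k; rewrite subr_ge0.
Qed.

Lemma bounded_seq_norm f : bounded_seq f -> bounded_seq (fun k => `|f k|).
Proof. by move=> [b fb]; exists b => k; rewrite normr_id. Qed.

Lemma mean_abs f : bounded_seq f -> `|m f| <= m (fun k => `|f k|).
Proof.
move=> bf; have bnf := bounded_seq_norm bf.
have bNf := bounded_seqZ (-1) bf.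
rewrite ler_norml; apply/andP; split.
  rewrite lerNl -mulN1r -meanZ//; apply: mean_le => // k.
  by rewrite mulN1r -normrN ler_norm.
by apply: mean_le => // k; exact: ler_norm.
Qed.

Lemma mean_abs_mul f g (b : R) : (forall k, `|f k| <= b) -> bounded_seq g ->
  `|m (fun k => f k * g k)| <= b * m (fun k => `|g k|).
Proof.
move=> fb bg; have bf : bounded_seq f by exists b.
have bfg := bounded_seqM bf bg.
rewrite (le_trans (mean_abs bfg))// -meanZ; last exact: bounded_seq_norm.
apply: mean_le.
- exact: bounded_seq_norm.
- exact/bounded_seqZ/bounded_seq_norm.
- by move=> k; rewrite normrM ler_wpM2r.
Qed.

End mean_theory.

(** Positivity on [b + f] and [b - f] yields the norm bound. Positivity is the property that can be
    checked directly for the two parts into which [extreme_mean_density] splits [m]. *)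
Lemma positive_invariant_mean (R : realType) (m : (nat -> R) -> R) :
  (forall (a : R) f g, bounded_seq f -> bounded_seq g ->
    m (fun k => a * f k + g k) = a * m f + m g) ->
  (forall f, bounded_seq f -> (forall k, 0 <= f k) -> 0 <= m f) ->
  m (fun=> 1) = 1 -> (forall f, bounded_seq f -> m (fun k => f k.+1) = m f) ->
  (forall f, ~ bounded_seq f -> m f = 0) -> invariant_mean m.
Proof.
move=> hlin hpos h1 hS hj; split => // f b fb.
have bf : bounded_seq f by exists b.
have b1 := @bounded_seq_cst R 1; have b0 := @bounded_seq_cst R 0.
have m0 : m (fun=> 0) = 0.
  by have := hlin 1 _ _ b0 b0; rewrite /= mulr0 addr0 mul1r; lra.
have mb : m (fun k => b * 1 + 0) = b by rewrite hlin// h1 m0 mulr1 addr0.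
have bb : bounded_seq (fun k : nat => b * 1 + 0) by exact: bounded_seq_cst.
rewrite ler_norml; apply/andP; split.
  have := hpos (fun k => 1 * f k + (b * 1 + 0)) (bounded_seqD (bounded_seqZ 1 bf) bb).
  rewrite hlin// mb mul1r => h; rewrite -subr_ge0 opprK; apply: h => k.
  by have := fb k; rewrite ler_norml; lra.
have := hpos (fun k => (-1) * f k + (b * 1 + 0)) (bounded_seqD (bounded_seqZ (-1) bf) bb).
rewrite hlin// mb mulN1r => h; rewrite -subr_ge0 addrC; apply: h => k.
by have := fb k; rewrite ler_norml; lra.
Qed.

Section orbit_mean.
Variables (R : realType) (T : pseudoPMetricType R) (phi : T -> T).
Hypothesis cT : compact [set: T].
Hypothesis cphi : continuous phi.
Variables (m : (nat -> R) -> R) (w0 : T).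
Hypothesis hm : invariant_mean m.

Definition orbit_mean (x : T -> R) := m (fun k => x (iter k phi w0)).
Local Notation nu := orbit_mean.

Lemma bounded_orbit (x : T -> R) : continuous x -> bounded_seq (fun k => x (iter k phi w0)).
Proof. by move=> cx; have [b hb] := compact_bounded cT cx; exists b. Qed.

Lemma orbit_mean_shift (x : T -> R) : continuous x -> nu (fun w => x (phi w)) = nu x.
Proof. by move=> cx; exact: (mean_shift hm (bounded_orbit cx)). Qed.

Lemma orbit_mean_positive : positive_functional nu.
Proof.
split.
- by move=> f cf f0; apply: (mean_ge0 hm) => //; exact: bounded_orbit.
- by move=> f g cf cg _ _; apply: (meanD hm); exact: bounded_orbit.
- by move=> a f _ cf _; apply: (meanZ hm); exact: bounded_orbit.
Qed.

Lemma orbit_mean1 : nu (fun=> 1) = 1.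
Proof. exact: mean1. Qed.

Lemma measurable_continuous_self : measurable_fun setT (phi : borelT T -> borelT T).
Proof.
apply: (@measurability _ _ (borelT T) (borelT T) setT phi (@open T)) => //.
move=> _ [U oU <-]; rewrite setTI; apply: borel_open.
by apply: open_comp => // x _; exact: cphi.
Qed.

Lemma measurable_preimage (A : set (borelT T)) : measurable A -> measurable (phi @^-1` A : set (borelT T)).
Proof. by move=> mA; rewrite -[_ @^-1` _]setTI; exact: measurable_continuous_self. Qed.

(** Approximation from below gives one inequality on open sets, and outer regularity carries it to
    all Borel sets. The reverse inequality is the same one for the complement, as [P] has total mass
    1. *)
Lemma Riesz_shift_invariant (P : probability (borelT T) R) :
  (forall A (e : R), 0 < e -> exists U : set T, [/\ open U, A `<=` U & (P U <= P A + e%:E)%E]) ->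
  (forall (U : set T) f, open U -> below U f -> ((nu f)%:E <= P U)%E) ->
  (forall (U : set T) (e : R), open U -> 0 < e ->
    exists2 f, below U f & (P U <= (nu f + e)%:E)%E) ->
  forall A : set (borelT T), measurable A -> P (phi @^-1` A) = P A.
Proof.
move=> Preg Pub Padh.
have hnu := orbit_mean_positive.
have leU (U : set T) : open U -> (P (phi @^-1` U) <= P U)%E.
  move=> oU; apply/lee_addgt0Pr => e e0; have e2 : 0 < e / 2 by lra.
  have oV : open (phi @^-1` U) by apply: open_comp => // x _; exact: cphi.
  have [f [cf f01 fU] hf] := Padh _ _ oV e2.
  have [u [cu u01 uU]] := open_support oU.
  have cuphi (n : nat) : continuous (fun w => n%:R * u (phi w)).
    by apply: cont_scale => x; apply: continuous_comp; [exact: cphi|exact: cu].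
  (* By compactness one factor [n] makes [g = min 1 (n * u)] equal to 1 at [phi w] wherever
     [f w >= e / 2]. The cut of [f] is then dominated by [g] composed with [phi], and shift
     invariance replaces that composition by [g], which is below [U]. *)
  have [n hn] : exists n, [set w | e / 2 <= f w] `<=` [set w | 1 < n%:R * u (phi w)].
    apply: (@compact_increasing_cover T _ (fun n => [set w | 1 < n%:R * u (phi w)])) => //.
    - exact: closed_preim_ge.
    - by move=> n; apply: open_preim_gt; exact: cuphi.
    - move=> n k nk w /= h; apply: (lt_le_trans h); rewrite ler_wpM2r ?ler_nat//.
      by case/andP: (u01 (phi w)).
    - move=> w /= ew; have up : 0 < u (phi w) by apply/uU; apply: fU; exact: lt_le_trans ew.
      exists (Num.truncn (u (phi w))^-1).+1 => //=.
      by rewrite -ltr_pdivrMr// div1r truncnS_gt.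
  pose g w := Num.min 1 (n%:R * u w).
  have cg : continuous g by apply: cont_min; [exact: cont_cst|exact: cont_scale].
  have u0 w : 0 <= u w by case/andP: (u01 w).
  have bg : below U g.
    split => //.
      by move=> w; rewrite le_min ler01 mulr_ge0//= ge_min lexx.
    move=> w; rewrite lt_min ltr01/= => h; apply/uU; rewrite lt_neqAle u0 andbT.
    by apply/eqP => u0'; move: h; rewrite -u0' mulr0 ltxx.
  have f0 w : 0 <= f w by case/andP: (f01 w).
  have hcut := positive_functional_cut hnu cf f0 (ltW e2).
  have cgphi : continuous (fun w => g (phi w)).
    by move=> x; apply: continuous_comp; [exact: cphi|exact: cg].
  have cfe : continuous (fun w => Num.max (f w - e / 2) 0).
    by apply: cont_max; [apply: cont_sub => //|]; exact: cont_cst.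
  have hfg : nu (fun w => Num.max (f w - e / 2) 0) <= nu g.
    rewrite -(orbit_mean_shift cg); apply: (positive_functional_le hnu) => //.
    move=> w; rewrite le_max lexx orbT/=.
    have [ew|ew] := leP (e / 2) (f w).
      rewrite /g (min_l (ltW (hn w ew))) ge_max ler01 andbT.
      by have := f01 w; lra.
    rewrite max_r; last by rewrite subr_le0 ltW.
    by rewrite /g le_min ler01 mulr_ge0.
  apply: (le_trans hf); apply: (@le_trans _ _ ((nu g)%:E + e%:E)%E); last first.
    by apply: leeD => //; exact: Pub.
  by rewrite -EFinD lee_fin; move: hcut hfg; rewrite orbit_mean1; lra.
have leA (A : set (borelT T)) : measurable A -> (P (phi @^-1` A) <= P A)%E.
  move=> mA; apply/lee_addgt0Pr => e e0; have [U [oU AU hU]] := Preg A e e0.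
  apply: le_trans hU; apply: le_trans (leU U oU).
  have mpA := measurable_preimage mA.
  have mpU := measurable_preimage (borel_open oU).
  by apply: le_measure; rewrite ?inE//; exact: preimage_subset.
move=> A mA; apply/eqP; rewrite eq_le leA//=.
have mB := measurable_preimage mA.
have := leA _ (measurableC mA); rewrite preimage_setC !probability_setC//.
rewrite -(fineK (fin_num_measure P _ mA)) -(fineK (fin_num_measure P _ mB)).
by rewrite -!EFinB !lee_fin; lra.
Qed.

End orbit_mean.

Section ergodicity.
Variables (R : realType) (T : pseudoPMetricType R) (phi : T -> T).
Hypothesis cT : compact [set: T].
Hypothesis cphi : continuous phi.
Variables (m : (nat -> R) -> R) (w0 : T).
Hypothesis hm : invariant_mean m.
Hypothesis extreme : forall m1 m2 (t : R), invariant_mean m1 -> invariant_mean m2 ->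
  0 < t < 1 -> (forall f, bounded_seq f -> m f = t * m1 f + (1 - t) * m2 f) -> m1 = m.
Local Notation nu := (orbit_mean phi m w0).

(* Almost invariance of the [g n] makes [f |-> lim m (f * g n)] an invariant functional
   dominated by [m], hence a multiple of [m] by extremality. *)
Lemma extreme_mean_density (g : nat -> nat -> R) (e : nat -> R) (a : R)
    (q : set_system nat) : UltraFilter q -> 0 < a < 1 ->
  (forall n k, 0 <= g n k <= 1) ->
  (forall d : R, 0 < d -> q [set n | e n <= d]) ->
  (forall n, m (fun k => `|g n k - g n k.+1|) <= e n) ->
  ulim q (fun n => m (g n)) = a ->
  forall f, bounded_seq f -> ulim q (fun n => m (fun k => f k * g n k)) = a * m f.
Proof.
move=> qU /andP[a0 a1] g01 qe gS ga.
have bg n : bounded_seq (g n).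
  by exists 1 => k; have := g01 n k; rewrite ler_norml; lra.
have g0 n k : 0 <= g n k by case/andP: (g01 n k).
have g1 n k : g n k <= 1 by case/andP: (g01 n k).
pose L f := ulim q (fun n => m (fun k => f k * g n k)).
have ubL f : bounded_seq f -> ubounded q (fun n => m (fun k => f k * g n k)).
  move=> [b fb]; apply: (@ubounded_all _ _ _ _ _ b) => n; apply: (mean_norm hm) => k.
  rewrite normrM -[leRHS]mulr1 ler_pM// ger0_norm//.
have Llin (c : R) f h : bounded_seq f -> bounded_seq h -> L (fun k => c * f k + h k) = c * L f + L h.
  move=> bf bh; rewrite /L -ulimZ; last exact: ubL.
  rewrite -ulimD; [|exact/uboundedZ/ubL|exact: ubL].
  congr ulim; apply/funext => n; rewrite -(mean_linear hm); try exact: bounded_seqM.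
  by congr m; apply/funext => k; rewrite mulrDl mulrA.
have L0 f : bounded_seq f -> (forall k, 0 <= f k) -> 0 <= L f.
  move=> bf f0; rewrite -(ulim_cst qU 0); apply: ulim_le.
  - exact: ubounded_cst.
  - exact: ubL.
  - apply: filterS filterT => n _ /=; apply: (mean_ge0 hm); first exact: bounded_seqM.
    by move=> k; rewrite mulr_ge0.
have Lm f : bounded_seq f -> (forall k, 0 <= f k) -> L f <= m f.
  move=> bf f0; rewrite -(ulim_cst qU (m f)); apply: ulim_le.
  - exact: ubL.
  - exact: ubounded_cst.
  - apply: filterS filterT => n _ /=; apply: (mean_le hm) => //; first exact: bounded_seqM.
    by move=> k; rewrite ler_piMr.
have L1 : L (fun=> 1) = a.
  by rewrite -ga; congr ulim; apply/funext => n; congr m; apply/funext => k; rewrite mul1r.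
(* Shift invariance of [m] turns the defect into the limit of [m] of [f k.+1 * (g n k - g n k.+1)],
   of size at most the bound of [f] times [e n]. *)
have LS f : bounded_seq f -> L (fun k => f k.+1) = L f.
  move=> bf; have bSf := bounded_seqS bf; have [b fb] := bf.
  apply: ulimE => // d d0; have d2 : 0 < d / 2 by lra.
  have b1 : 0 < `|b| + 1 by rewrite ltr_wpDl.
  have db : 0 < d / 2 / (`|b| + 1) by rewrite divr_gt0.
  apply: filterS2 (qe _ db) (ulimP qU (ubL _ bf) d2) => n /= hn.
  have bSg := bounded_seqS (bg n).
  have -> : m (fun k => f k * g n k) = m (fun k => f k.+1 * g n k.+1).
    by rewrite (mean_shift hm (f := fun k => f k * g n k))//; exact: bounded_seqM.
  have : `|m (fun k => f k.+1 * (g n k - g n k.+1))| <= d / 2.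
    apply: (le_trans (mean_abs_mul hm (b := b) _ _)) => //; first exact: bounded_seqB.
    apply: (@le_trans _ _ ((`|b| + 1) * m (fun k => `|g n k - g n k.+1|))).
      rewrite ler_wpM2r//; last by have := ler_norm b; lra.
      by apply: (mean_ge0 hm) => //; exact/bounded_seq_norm/bounded_seqB.
    by rewrite -ler_pdivlMl// mulrC (le_trans (gS n)).
  have -> : (fun k => f k.+1 * (g n k - g n k.+1)) = (fun k => f k.+1 * g n k - f k.+1 * g n k.+1).
    by apply/funext => k; rewrite mulrBr.
  rewrite (meanB hm); try exact: bounded_seqM.
  by rewrite -/(L f) !ler_norml; lra.
(* The splitting is [m = a * m1 + (1 - a) * m2]; the value 0 at unbounded sequences is what
   [mean_junk] demands. *)
pose m1 f := if pselect (bounded_seq f) then a^-1 * L f else 0.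
pose m2 f := if pselect (bounded_seq f) then (1 - a)^-1 * (m f - L f) else 0.
have m1E f : bounded_seq f -> m1 f = a^-1 * L f by rewrite /m1; case: pselect.
have m2E f : bounded_seq f -> m2 f = (1 - a)^-1 * (m f - L f) by rewrite /m2; case: pselect.
have bc := @bounded_seq_cst R 1.
have a1' : 0 < 1 - a by rewrite subr_gt0.
have h1 : invariant_mean m1.
  apply: positive_invariant_mean.
  - move=> c f h bf bh; have bfh := bounded_seqD (bounded_seqZ c bf) bh.
    by rewrite !m1E// Llin// mulrDr mulrCA.
  - by move=> f bf f0; rewrite m1E// mulr_ge0 ?L0// invr_ge0 ltW.
  - by rewrite m1E// L1 mulVf// gt_eqF.
  - by move=> f bf; rewrite !m1E ?LS//; exact: bounded_seqS.
  - by move=> f nbf; rewrite /m1; case: pselect.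
have h2 : invariant_mean m2.
  apply: positive_invariant_mean.
  - move=> c f h bf bh; have bfh := bounded_seqD (bounded_seqZ c bf) bh.
    by rewrite !m2E// Llin// (mean_linear hm)//; ring.
  - by move=> f bf f0; rewrite m2E// mulr_ge0 ?subr_ge0 ?Lm// invr_ge0 ltW.
  - by rewrite m2E// L1 (mean1 hm) mulVf// gt_eqF.
  - by move=> f bf; rewrite !m2E ?LS ?(mean_shift hm)//; exact: bounded_seqS.
  - by move=> f nbf; rewrite /m2; case: pselect.
have a01 : 0 < a < 1 by apply/andP.
have m1m : m1 = m.
  apply: (extreme h1 h2 a01) => f bf.
  by rewrite m1E// m2E// !mulrA !divff ?mul1r ?gt_eqF//; ring.
move=> f bf; rewrite -[ulim _ _]/(L f) -m1m m1E//.
by rewrite mulrA divff ?mul1r// gt_eqF.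
Qed.

(** With [a = P A] and [g n] the orbit values of approximations [h n] of the indicator of [A],
    [extreme_mean_density] gives that [m (g i * g n)] tends to [a * m (g i)]. Letting [i] grow, the
    left side approaches [P A = a] and the right side [a * a], so [a] is 0 or 1. The functional
    [nu'] is separate because the limit operator agrees with the orbit mean on continuous functions
    only. *)
Lemma orbit_mean_ergodic (nu' : (T -> R) -> R) :
  (forall x : T -> R, continuous x -> nu' x = nu x) -> ergodic_prob_functional phi nu'.
Proof.
move=> nuE.
have hnu := orbit_mean_positive phi cT w0 hm.
have [P [PI Preg Pub Padh]] := Riesz_probability cT hnu (orbit_mean1 phi w0 hm).
have Pinv := Riesz_shift_invariant cT cphi hm Preg Pub Padh.
have Pfin : (P setT < +oo)%E by rewrite (le_lt_trans (probability_le1 P measurableT))// ltry.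
pose I (f : T -> R) := (\int[P]_(w in setT) f w)%R.
have bcont (x : T -> R) : continuous x -> bounded_measurable x.
  exact: bounded_measurable_continuous.
have Inu (x : T -> R) : continuous x -> I x = nu x.
  move=> cx; have [b hb] := compact_bounded cT cx.
  have cc := @cont_cst R T b.
  have cxb := cont_add cx cc.
  have nub : nu (fun w => x w + b) = nu x + b.
    apply: etrans (meanD hm (bounded_orbit phi cT w0 cx) (bounded_seq_cst b)) _.
    by rewrite (mean_cst hm).
  have Ib : I (fun w => x w + b) = I x + b.
    rewrite /I RintegralD//; try exact/bounded_measurable_integrable/bcont.
    by rewrite Rintegral_cst// [X in fine X]probability_setT mulr1.
  apply: (addIr b); rewrite -nub -Ib; apply: PI => // w.
  by have := hb w; rewrite ler_norml; lra.
exists P; split; [|split => //].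
  by move=> x cx; rewrite continuous_integral_fin// nuE// -Inu.
move=> A mA iA.
pose a := fine (P A).
have PA : P A = a%:E by rewrite /a fineK// fin_num_measure.
have a0 : 0 <= a by rewrite fine_ge0.
have a1 : a <= 1 by rewrite -lee_fin -PA probability_le1.
have bA : bounded_measurable (\1_A : borelT T -> R) by exact: bounded_measurable_indic.
suff : a = 0 \/ a = 1 by rewrite PA => -[->|->]; [left|right].
have [->|/eqP a0'] := eqVneq a 0; first by left.
have [->|/eqP a1'] := eqVneq a 1; first by right.
exfalso.
have a01 : 0 < a < 1.
  by rewrite !lt_neqAle a0 a1 !andbT; apply/andP; split; apply/eqP => // /esym.
pose ei (n : nat) : R := n.+1%:R^-1.
have ei0 n : 0 < ei n by rewrite invr_gt0.
have /choice[h hP] (n : nat) : exists f : T -> R, [/\ continuous f, forall w, 0 <= f w <= 1,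
    I (fun w => `|f w - \1_A w|) <= ei n &
    I (fun w => `|f (phi w) - \1_A w|) <= ei n].
  (* One half of [ei n] pays for [U] around [A], the other for [f] below [U]. Since [A] is its own
     preimage, the same estimate holds for [f] composed with [phi] inside the preimage of [U], with
     the same measure and the same integral. *)
  have e0 : 0 < ei n / 2 by rewrite divr_gt0.
  have [U [oU AU hU]] := Preg A _ e0.
  have [f [cf f01 fU] hf] := Padh _ _ oU e0.
  have mU : measurable (U : set (borelT T)) by exact: borel_open.
  have mV : measurable (phi @^-1` U : set (borelT T)) by exact: measurable_preimage.
  have PU : P U = (fine (P U))%:E by rewrite fineK// fin_num_measure.
  have cfphi : continuous (fun w => f (phi w)).
    by move=> x; apply: continuous_comp; [exact: cphi|exact: cf].
  have fU1 w : 0 <= f w <= \1_U w.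
    have /andP[f0 f1] := f01 w; rewrite f0/= indicE.
    have [_|nU] := boolP (w \in U); first by [].
    by rewrite leNgt; apply/negP => /fU Uw; rewrite mem_set in nU.
  have Inf : I (fun w => f (phi w)) = I f by rewrite !Inu// (orbit_mean_shift _ cT).
  have PVU : P (phi @^-1` U) = P U by exact: Pinv.
  move: hU hf; rewrite PU PA -EFinD !lee_fin -(Inu _ cf) => hU hf.
  exists f; split => //.
  - have L : I (fun w => `|f w - \1_A w|) <= fine (P U) - I f + (fine (P U) - a).
      exact: (L1_gap P (bcont _ cf) mA mU AU fU1).
    by move: L hU hf; move: (ei n) => d; lra.
  - have AV : A `<=` phi @^-1` U by rewrite -iA; exact: preimage_subset.
    have fV w : 0 <= f (phi w) <= \1_(phi @^-1` U) w by exact: (fU1 (phi w)).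
    have L : I (fun w => `|f (phi w) - \1_A w|) <= fine (P U) - I f + (fine (P U) - a).
      by rewrite -Inf -PVU; exact: (L1_gap P (bcont _ cfphi) mA mV AV fV).
    by move: L hU hf; move: (ei n) => d; lra.
have ch n : continuous (h n) by case: (hP n).
have h01 n w : 0 <= h n w <= 1 by case: (hP n).
have hA n : I (fun w => `|h n w - \1_A w|) <= ei n by case: (hP n).
have hAphi n : I (fun w => `|h n (phi w) - \1_A w|) <= ei n by case: (hP n).
have chphi n : continuous (fun w => h n (phi w)).
  by move=> x; apply: continuous_comp; [exact: cphi|exact: ch].
have I_le (f g : borelT T -> R) : bounded_measurable f -> bounded_measurable g ->
    (forall w, f w <= g w) -> I f <= I g.
  by move=> bf bg fg; apply: le_Rintegral => //; exact: bounded_measurable_integrable.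
have I_add (f g : borelT T -> R) : bounded_measurable f -> bounded_measurable g ->
    I (fun w => f w + g w) = I f + I g.
  by move=> bf bg; apply: RintegralD => //; exact: bounded_measurable_integrable.
have bhA n : bounded_measurable (fun w : borelT T => `|h n w - \1_A w|).
  by apply/bounded_measurable_norm/bounded_measurableB => //; exact: bcont.
have bhAphi n : bounded_measurable (fun w : borelT T => `|h n (phi w) - \1_A w|).
  by apply/bounded_measurable_norm/bounded_measurableB => //; exact: (bcont _ (chphi n)).
have [q [qU qlt]] := nonprincipal_ultra.
have qe (d : R) : 0 < d -> q [set n | 2 * ei n <= d].
  move=> d0; apply: filterS (qlt (Num.truncn (2 / d))) => n /= hn.
  rewrite /ei ler_pdivrMr// mulrC -ler_pdivrMr// ltW// (lt_le_trans (truncnS_gt _))// ler_nat.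
  exact: leqW.
pose g n k := h n (iter k phi w0).
have gE n : m (g n) = I (h n) by rewrite Inu.
have bg n : bounded_seq (g n) by exact: bounded_orbit.
have ha n : `|m (g n) - a| <= ei n.
  rewrite gE /a -Rintegral_indicator//.
  have -> : I (h n) - \int[P]_(w in setT) \1_A w = I (fun w => h n w - \1_A w).
    by rewrite /I RintegralB//; apply: bounded_measurable_integrable => //; exact: bcont.
  apply: le_trans (hA n); apply: le_normr_Rintegral => //.
  by apply: bounded_measurable_integrable; apply: bounded_measurableB => //; exact: bcont.
have gS n : m (fun k => `|g n k - g n k.+1|) <= 2 * ei n.
  have cd : continuous (fun w => `|h n w - h n (phi w)|) by apply: cont_norm; exact: cont_sub.
  have -> : m (fun k => `|g n k - g n k.+1|) = I (fun w => `|h n w - h n (phi w)|) by rewrite Inu.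
  apply: (@le_trans _ _ (I (fun w => `|h n w - \1_A w| + `|h n (phi w) - \1_A w|))).
    apply: I_le; [exact: bcont|exact: bounded_measurableD|].
    by move=> w; rewrite [X in _ <= _ + X]distrC; exact: ler_distD.
  by rewrite I_add//; have := hA n; have := hAphi n; lra.
have g01 n k : 0 <= g n k <= 1 by exact: h01.
have ga : ulim q (fun n => m (g n)) = a.
  apply: ulimE => // d d0; apply: filterS (qe d d0) => n /= hn.
  by have := ha n; rewrite !ler_norml; have := ei0 n; lra.
have key := extreme_mean_density qU a01 g01 qe gS ga.
have gg i n : `|m (fun k => g i k * g n k) - a| <= ei i + ei n.
  have cp : continuous (fun w => h i w * h n w) by exact: cont_mul.
  have -> : m (fun k => g i k * g n k) = I (fun w => h i w * h n w) by rewrite Inu.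
  rewrite /a -Rintegral_indicator//.
  have bp := bcont _ cp.
  have -> : I (fun w => h i w * h n w) - \int[P]_(w in setT) \1_A w =
      I (fun w => h i w * h n w - \1_A w).
    by rewrite /I RintegralB//; exact: bounded_measurable_integrable.
  have bpA := bounded_measurableB bp bA.
  apply: (@le_trans _ _ (I (fun w => `|h i w * h n w - \1_A w|))).
    by apply: le_normr_Rintegral => //; exact: bounded_measurable_integrable.
  apply: (@le_trans _ _ (I (fun w => `|h i w - \1_A w| + `|h n w - \1_A w|))).
    apply: I_le; [exact: bounded_measurable_norm|exact: bounded_measurableD|move=> w].
    have := h01 i w; have := h01 n w; set x := h i w; set y := h n w; rewrite indicE.
    have [_|_] := boolP (w \in A) => /= hy hx; last first.
      rewrite !subr0 !ger0_norm; nra.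
    rewrite !ler0_norm; nra.
  by rewrite I_add//; apply: lerD.
(* One [ei i] comes from [gg], one from [ei n <= ei i], one from the distance to the ultralimit.
   Replacing [m (g i)] by [a] costs a fourth in [aa]. *)
have a2 i : `|a * m (g i) - a| <= 3 * ei i.
  have i0 := ei0 i.
  have i2 : 0 < 2 * ei i by lra.
  have ugg : ubounded q (fun n => m (fun k => g i k * g n k)).
    apply: (@ubounded_all _ _ _ _ _ 1) => n; apply: (mean_norm hm) => k.
    by rewrite normrM !ger0_norm ?mulr_ile1//; case/andP: (g01 i k); case/andP: (g01 n k).
  rewrite -key//.
  have [n [/= h1 h2]] := filter_ex (filterI (qe _ i2) (ulimP qU ugg i0)).
  by have := gg i n; move: h2; rewrite !ler_norml; lra.
have aa i : a * (1 - a) <= 4 * ei i.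
  have i0 := ei0 i.
  have := a2 i; have := ha i; rewrite !ler_norml => /andP[_ h1] /andP[h2 _].
  have : a * m (g i) <= a * (a + ei i) by rewrite ler_wpM2l//; lra.
  have : a * ei i <= ei i by rewrite ler_piMl// ltW.
  lra.
have c0 : 0 < a * (1 - a) by rewrite mulr_gt0//; case/andP: a01; lra.
have := aa (Num.truncn (4 / (a * (1 - a)))).
rewrite /ei ler_pdivlMr// mulrC -ler_pdivlMr//; apply/negP; rewrite -ltNge.
exact: truncnS_gt.
Qed.

End ergodicity.

(** * Sequences of convex combinations *)

(** Independence gives a point following the signs of the coefficients [a k] and another following
    the opposite signs. The two sums differ by at least [s - r], since the [|a k|] add up to 1,
    whereas tameness with [eps = (s - r) / 4] bounds the difference by [(s - r) / 2]. *)
Lemma tame_not_independent (R : realType) (T : pseudoPMetricType R) (phi : T -> T)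
    (x : T -> R) (nk : nat -> nat) (r s : R) : tame phi -> continuous x ->
  (forall k, (nk k < nk k.+1)%N) -> r < s ->
  ~ independent (fun n w => x (iter (nk n) phi w)) r s.
Proof.
move=> ht cx hnk rs hind.
have e0 : 0 < (s - r) / 4 by lra.
have [K [a [a1 ha]]] := ht x nk cx hnk _ e0.
have [w hw] := hind K (fun k => 0 <= a k).
have [w' hw'] := hind K (fun k => ~~ (0 <= a k)).
have : s - r <= \sum_(k < K) a k * x (iter (nk k) phi w) -
               \sum_(k < K) a k * x (iter (nk k) phi w').
  rewrite -sumrB -[s - r]mul1r -a1 mulr_suml; apply: ler_sum => k _.
  rewrite -mulrBr; have := hw k (ltn_ord k); have := hw' k (ltn_ord k).
  have [a0|a0] /= := leP 0 (a k) => h1 h2.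
    by rewrite ger0_norm// ler_wpM2l//; lra.
  by rewrite ltr0_norm// mulNr -mulrN ler_nM2l//; lra.
have := ha w; have := ha w'; rewrite !ler_norml; lra.
Qed.

(** A form of separability of the continuous functions: the [psi l] are the members of normalized
    partitions of unity over finite lists of basic open sets. A function oscillating little on each
    set of such a list is close to a combination with one coefficient per set. Countability is what
    the diagonal choice of a sequence requires. *)
Lemma countable_partition_family (R : realType) (T : pseudoPMetricType R) :
  compact [set: T] -> exists psi : nat -> T -> R,
    [/\ forall l, continuous (psi l), forall l w, `|psi l w| <= 1 &
    forall (x : T -> R) (e : R), continuous x -> 0 < e ->
      exists n (a : nat -> R) (l : nat -> nat),
        forall w, `|x w - \sum_(i < n) a i * psi (l i) w| <= e].
Proof.
move=> cT; have [B cB [oB bB]] := compact_second_countable cT.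
have [U [oU bU]] : exists U : nat -> set T, (forall n, open (U n)) /\
    forall w A, nbhs w A -> exists n, U n w /\ U n `<=` A.
  have /pfcard_geP[B0|[F]] := cB.
    have [V [BV _] _] := bB point setT filterT.
    by exfalso; rewrite B0 in BV.
  exists F; split; first by move=> n; apply: oB; exact: funS.
  move=> w A /bB[V [BV Vw] VA]; have [n _ nV] := @surj _ _ _ _ F _ BV.
  by exists n; rewrite nV.
have /choice[e eP] n := open_support (oU n).
have ec n : continuous (e n) by case: (eP n).
have e0 n w : 0 <= e n w by case: (eP n) => _ /(_ w)/andP[].
have eU n w : 0 < e n w <-> U n w by case: (eP n) => _ _; exact.
pose S (s : seq nat) w := \sum_(i < size s) e (nth 0%N s i) w.
have cS s : continuous (S s) by apply: (@cont_sum _ _ (size s) (fun i w => e (nth 0%N s i) w)).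
(* Lists whose bumps do not cover the space, and positions beyond the list, are sent to the zero
   function. *)
pose psi0 (p : seq nat * nat) w : R :=
  if `[< (p.2 < size p.1)%N /\ forall w, 0 < S p.1 w >] then
    e (nth 0%N p.1 p.2) w / S p.1 w else 0.
have psi0c p : continuous (psi0 p).
  rewrite /psi0; case: asboolP => [[_ hp]|_]; last exact: cont_cst.
  apply: cont_mul => // w; apply: cvgV; last exact: cS.
  by rewrite gt_eqF.
have psi0b p w : `|psi0 p w| <= 1.
  rewrite /psi0; case: asboolP => [[hi hp]|_]; last by rewrite normr0.
  rewrite ger0_norm; last by rewrite divr_ge0// ltW.
  rewrite ler_pdivrMr// mul1r /S (bigD1 (Ordinal hi))//= lerDl.
  by apply: sumr_ge0.
exists (fun l => if @unpickle (seq nat * nat)%type l is Some p then psi0 p else fun=> 0).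
split.
- by move=> l; case: unpickle => [p|]; [exact: psi0c|exact: cont_cst].
- by move=> l w; case: unpickle => [p|]; [exact: psi0b|rewrite normr0].
move=> x d cx d0.
pose D := [set n | exists c : R, forall w, U n w -> `|x w - c| <= d].
have hD : finite_subset_cover D U [set: T].
  have := cT; rewrite compact_cover => H; apply: H; first by move=> n _; exact: oU.
  move=> w _; have : nbhs w [set v | `|x v - x w| <= d].
    have /cvgrPdist_le/(_ d d0) := cx w.
    by apply: filterS => v /=; rewrite distrC.
  by move=> /bU[n [Unw UA]]; exists n => //; exists (x w).
have [F FD FT] := hD.
pose s : seq nat := finmap.enum_fset F.
have /choice[c hc] n : exists c : R, n \in s -> forall w, U n w -> `|x w - c| <= d.
  have [ns|] := boolP (n \in s); last by exists 0.
  by have /set_mem[c hc] := FD n ns; exists c.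
have Spos w : 0 < S s w.
  have [n /= nF Unw] := FT w Logic.I.
  have ns : (index n s < size s)%N by rewrite index_mem.
  rewrite /S (bigD1 (Ordinal ns))//= nth_index// ltr_pwDl//; first exact/eU.
  by apply: sumr_ge0.
exists (size s), (fun i => c (nth 0%N s i)), (fun i => pickle (s, i)) => w.
have psiE i : (i < size s)%N -> psi0 (s, i) w = e (nth 0%N s i) w / S s w.
  by move=> hi; rewrite /psi0; case: asboolP => // -[].
have -> : x w - \sum_(i < size s) c (nth 0%N s i) *
    (if @unpickle (seq nat * nat)%type (pickle (s, nat_of_ord i)) is Some p then psi0 p else fun=> 0) w =
    (\sum_(i < size s) (x w - c (nth 0%N s i)) * e (nth 0%N s i) w) / S s w.
  under eq_bigr => i _ do rewrite pickleK psiE// mulrA.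
  under [in RHS]eq_bigr => i _ do rewrite mulrBl.
  by rewrite sumrB -mulr_sumr -mulr_suml -/(S s w) mulrBl mulfK// gt_eqF.
rewrite normrM [`|(S s w)^-1|]ger0_norm ?invr_ge0 ?(ltW (Spos w))//.
rewrite ler_pdivrMr// (le_trans (ler_norm_sum _ _ _))// /S mulr_sumr.
apply: ler_sum => i _; rewrite normrM (ger0_norm (e0 _ _)).
have [->|/eqP ne0] := eqVneq (e (nth 0%N s i) w) 0; first by rewrite !mulr0.
rewrite ler_wpM2r//; apply: hc; first exact: mem_nth.
by apply/eU; rewrite lt_neqAle e0 andbT; apply/eqP => h; exact: ne0.
Qed.

(** * Approximating a mean by convex combinations of point evaluations *)

Section convex_combinations.
Variable R : realType.

Definition convex_comb := {p : nat * (nat -> R) |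
  (forall k, 0 <= p.2 k) /\ \sum_(k < p.1) p.2 k = 1}.

Definition comb_eval (i : convex_comb) (f : nat -> R) : R :=
  \sum_(k < (sval i).1) (sval i).2 k * f k.

Lemma comb_eval_norm (i : convex_comb) (f : nat -> R) (b : R) :
  (forall k, `|f k| <= b) -> `|comb_eval i f| <= b.
Proof.
move=> fb; have [c0 c1] := svalP i; rewrite /comb_eval (le_trans (ler_norm_sum _ _ _))//.
apply: (@le_trans _ _ ((\sum_(k < (sval i).1) (sval i).2 k) * b)); last by rewrite c1 mul1r.
rewrite mulr_suml; apply: ler_sum => k _.
by rewrite normrM ger0_norm// ler_wpM2l.
Qed.

Variable m : (nat -> R) -> R.
Hypothesis hm : invariant_mean m.

Lemma mean_sum (J : finType) (f : J -> nat -> R) : (forall j, bounded_seq (f j)) ->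
  m (fun k => \sum_j f j k) = \sum_j m (f j).
Proof.
move=> bf.
have : bounded_seq (fun k => \sum_(j <- index_enum J) f j k) /\
    m (fun k => \sum_(j <- index_enum J) f j k) = \sum_(j <- index_enum J) m (f j).
  elim: (index_enum J) => [|j s [bs ih]].
    split; first by exists 0 => k; rewrite big_nil normr0.
    by rewrite big_nil -[RHS](mean_zero hm); congr m; apply/funext => k; rewrite big_nil.
  have E : (fun k => \sum_(j0 <- j :: s) f j0 k) = (fun k => f j k + \sum_(j0 <- s) f j0 k).
    by apply/funext => k; rewrite big_cons.
  by rewrite E; split; [exact: bounded_seqD|rewrite big_cons -ih (meanD hm)].
by case.
Qed.

(* Partition the integers into finitely many cells on which all the [f j] are
   almost constant and put the mass of each cell at one of its points. *)
Lemma mean_approximation (r : nat) (f : nat -> nat -> R) (e : R) :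
  (forall j, bounded_seq (f j)) -> 0 < e ->
  exists i : convex_comb, forall j, (j < r)%N -> `|comb_eval i (f j) - m (f j)| <= e.
Proof.
move=> bf e0; have /choice[b hb] := bf.
(* After this normalisation two values of [f j] with the same integer part differ by at most [e],
   and finitely many integer parts occur. *)
pose y j k := (f j k + b j) / e.
have y0 j k : 0 <= y j k.
  by rewrite divr_ge0 ?(ltW e0)//; have := hb j k; rewrite ler_norml; lra.
pose M := (\max_(j < r) Num.truncn (2 * b j / e))%N.
have yM (j : 'I_r) k : (Num.truncn (y j k) < M.+1)%N.
  rewrite ltnS; apply: (@leq_trans (Num.truncn (2 * b j / e))).
    apply: le_truncn; rewrite ler_wpM2r ?invr_ge0 ?(ltW e0)//.
    by have := hb j k; rewrite ler_norml; lra.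
  exact: (@leq_bigmax _ (fun j : 'I_r => Num.truncn (2 * b j / e)) j).
pose X := {ffun 'I_r -> 'I_M.+1}.
pose cell k : X := [ffun j => Ordinal (yM j k)].
have cellP k k' (j : 'I_r) : cell k = cell k' -> `|f j k - f j k'| <= e.
  move=> /ffunP/(_ j); rewrite !ffunE => /(congr1 val) /= E.
  have := truncn_itv (y0 j k); have := truncn_itv (y0 j k'); rewrite E.
  set t := Num.truncn _; rewrite /y !ler_pdivlMr// !ltr_pdivrMr// -natr1 mulrDl mul1r.
  by rewrite ler_norml; lra.
pose ind (t : X) k : R := (cell k == t)%:R.
have ind0 t k : 0 <= ind t k by exact: ler0n.
have bind t : bounded_seq (ind t).
  by exists 1 => k; rewrite ger0_norm// /ind; case: eqP.
pose p t := m (ind t).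
have p0 t : 0 <= p t by apply: (mean_ge0 hm).
have ind1 k : \sum_t ind t k = 1.
  rewrite (bigD1 (cell k))//= /ind eqxx big1 ?addr0// => t.
  by rewrite eq_sym => /negbTE ->.
have p1 : \sum_t p t = 1.
  rewrite -(mean_sum bind) -[RHS](mean1 hm); congr m.
  by apply/funext => k; exact: ind1.
(* An empty cell gets the representative 0; its indicator is zero, so it carries no mass. *)
have /choice[rep repP] (t : X) : exists k, forall k', cell k' = t -> cell k = t.
  have [[k kt]|h] := pselect (exists k, cell k = t); first by exists k.
  by exists 0%N => k' k't; exfalso; apply: h; exists k'.
pose N := (\max_t rep t).+1.
have repN t : (rep t < N)%N by rewrite ltnS; exact: (@leq_bigmax _ rep t).
pose c k := \sum_(t | rep t == k) p t.
have cE (g : nat -> R) : \sum_(k < N) c k * g k = \sum_t p t * g (rep t).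
  under eq_bigr => k _ do rewrite /c mulr_suml big_mkcond.
  rewrite exchange_big/=; apply: eq_bigr => t _.
  rewrite (bigD1 (Ordinal (repN t)))//= eqxx big1 ?addr0// => k.
  by rewrite -val_eqE/= eq_sym => /negbTE ->.
have hc : (forall k, 0 <= (N, c).2 k) /\ \sum_(k < (N, c).1) (N, c).2 k = 1.
  split; first by move=> k; exact: sumr_ge0.
  apply: (@etrans _ _ (\sum_(k < N) c k * 1)).
    by apply: eq_bigr => k _; rewrite mulr1.
  by rewrite (cE (fun=> 1)) -[RHS]p1; apply: eq_bigr => t _; rewrite mulr1.
exists (exist _ (N, c) hc) => j jr; rewrite /comb_eval/= cE.
have bfi t : bounded_seq (fun k => f j k * ind t k) by exact: bounded_seqM.
have -> : m (f j) = \sum_t m (fun k => f j k * ind t k).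
  rewrite -(mean_sum bfi); congr m; apply/funext => k.
  by rewrite -mulr_sumr ind1 mulr1.
rewrite -sumrB (le_trans (ler_norm_sum _ _ _))// -[e]mulr1 -p1 mulr_sumr.
apply: ler_sum => t _; rewrite mulrC -(meanZ hm)// -(meanB hm)//; last exact: bounded_seqZ.
rewrite -(meanZ hm)//; apply: (le_trans (mean_abs hm _)).
  by apply: bounded_seqB => //; exact: bounded_seqZ.
apply: (mean_le hm).
- by apply: bounded_seq_norm; apply: bounded_seqB => //; exact: bounded_seqZ.
- exact: bounded_seqZ.
move=> k; rewrite -mulrBl normrM (ger0_norm (ind0 _ _)) /ind.
have [kt|_] := eqVneq (cell k) t; last by rewrite !mulr0.
by rewrite !mulr1; apply: (cellP _ _ (Ordinal jr)); rewrite kt; exact: (repP t k kt).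
Qed.

(** Finitely many tests within a tolerance generate a filter; [mean_approximation] says precisely
    that it is proper, and any ultrafilter above it converges to [m]. *)
Lemma mean_ultrafilter : exists q : set_system convex_comb, UltraFilter q /\
  forall f, bounded_seq f -> ulim q (fun i => comb_eval i f) = m f.
Proof.
pose B : set_system convex_comb := [set X | exists r (f : nat -> nat -> R) (e : R),
  [/\ forall j, bounded_seq (f j), 0 < e &
   forall i, (forall j, (j < r)%N -> `|comb_eval i (f j) - m (f j)| <= e) -> X i]].
have BF : ProperFilter B.
  apply: Build_ProperFilter_ex.
    move=> X [r [f [e [bf e0 hX]]]]; have [i hi] := mean_approximation r bf e0.
    by exists i; exact: hX.
  split.
  - by exists 0%N, (fun _ _ => 0), 1; split => // j; exact: bounded_seq_cst.
  - move=> X Y [r [f [e [bf e0 hX]]]] [r' [f' [e' [bf' e0' hY]]]].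
    exists (r + r')%N, (fun j => if (j < r)%N then f j else f' (j - r)%N), (Num.min e e').
    split; [by move=> j; case: ifP|by rewrite lt_min e0|].
    move=> i hi; split.
      apply: hX => j jr; have := hi j (ltn_addr _ jr); rewrite jr => /le_trans; apply.
      by rewrite ge_min lexx.
    apply: hY => j jr; have := hi (r + j)%N; rewrite ltn_add2l => /(_ jr).
    rewrite ltnNge leq_addr/= addKn => /le_trans; apply.
    by rewrite ge_min lexx orbT.
  - move=> X Y XY [r [f [e [bf e0 hX]]]]; exists r, f, e; split => // i hi.
    exact/XY/hX.
have [q [qU Bq]] := ultraFilterLemma BF.
exists q; split => // f bf; apply: ulimE => e e0; apply: Bq.
by exists 1%N, (fun=> f), e; split => // i /(_ 0%N); exact.
Qed.

End convex_combinations.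

Lemma cvg_sum_seq (R : realType) (n : nat) (u : nat -> nat -> R) (l : nat -> R) :
  (forall i, u i k @[k --> \oo] --> l i) ->
  \sum_(i < n) u i k @[k --> \oo] --> \sum_(i < n) l i.
Proof.
move=> ul; elim: n => [|n ih].
  rewrite big_ord0; under eq_fun do rewrite big_ord0; exact: cvg_cst.
rewrite big_ord_recr/=; under eq_fun do rewrite big_ord_recr/=; exact: cvgD.
Qed.

(** * Pointwise convergent convex combinations in a tame system *)

Section tame_systems.
Variables (R : realType) (T : pseudoPMetricType R) (phi : T -> T).
Hypothesis cT : compact [set: T].
Hypothesis cphi : continuous phi.
Hypothesis htame : tame phi.

Lemma continuous_iter k : continuous (fun w => iter k phi w).
Proof.
elim: k => [|k ih] w /=; first exact: cvg_id.
by apply: continuous_comp; [exact: ih|exact: cphi].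
Qed.

Lemma continuous_orbit (x : T -> R) k : continuous x -> continuous (fun w => x (iter k phi w)).
Proof. by move=> cx w; apply: continuous_comp; [exact: continuous_iter|exact: cx]. Qed.

(** The sequence is selected for the countably many [psi l]. It then works for every [x], which is
    uniformly within [e / 3] of a finite combination of them, because [comb_eval (i N)] and [m] do
    not increase sup norms. *)
Lemma tame_mean_sequence (m : (nat -> R) -> R) : invariant_mean m ->
  exists i : nat -> convex_comb R, forall (x : T -> R) w, continuous x ->
    comb_eval (i n) (fun k => x (iter k phi w)) @[n --> \oo] --> orbit_mean phi m w x.
Proof.
move=> hm; have [psi [cpsi bpsi dpsi]] := countable_partition_family cT.
have [q [qU qm]] := mean_ultrafilter hm.
pose g l (i : convex_comb R) w := comb_eval i (fun k => psi l (iter k phi w)).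
have cg l i : continuous (g l i).
  apply: (@cont_sum _ _ (sval i).1 (fun k w => (sval i).2 k * psi l (iter k phi w))) => k.
  by apply: cont_scale; exact: continuous_orbit.
have bg l i w : `|g l i w| <= 1 by apply: comb_eval_norm => k; exact: bpsi.
have qtrue (i : convex_comb R) : q ((fun _ _ => True) i) by exact: filterT.
have noind l (r s : R) (i : nat -> convex_comb R) : r < s -> (forall n : nat, True) ->
    ~ independent (fun n => g l (i n)) r s.
  move=> rs _; apply: (@convex_hull_not_independent _ _
    (fun k w => psi l (iter k phi w)) 1 cT _ _ _
    (fun n => (sval (i n)).2) (fun n => (sval (i n)).1) _ _ rs).
  - by move=> k; exact: continuous_orbit.
  - by move=> k w; exact: bpsi.
  - by move=> r' s' nk rs' hnk; exact: tame_not_independent.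
  - by move=> n; have := svalP (i n).
have cov l (e : R) : 0 < e -> exists M : nat -> set (convex_comb R), (forall n, q (M n)) /\
    forall w, exists n, forall i j, M n i -> M n j -> `|g l i w - g l j w| <= e.
  exact: (@countable_cover R T _ q (g l) 1 (fun _ _ => True) qU (cg l) (bg l) qtrue (noind l)
    e (compact_second_countable cT)).
have [i [_ hi]] := ultralimit_sequence (b := fun=> 1) qU bg qtrue cov.
exists i => x w cx; apply/cvgrPdist_le => e e0.
have e3 : 0 < e / 3 by lra.
have [n [a [l hx]]] := dpsi x _ cx e3.
pose y v := \sum_(j < n) a j * psi (l j) v.
have cy : continuous y.
  by apply: (@cont_sum _ _ n (fun j v => a j * psi (l j) v)) => j; exact: cont_scale.
have bx := bounded_orbit phi cT w cx; have by_ := bounded_orbit phi cT w cy.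
have bl j := bounded_orbit phi cT w (cpsi j).
have close_comb N : `|comb_eval (i N) (fun k => x (iter k phi w)) -
    comb_eval (i N) (fun k => y (iter k phi w))| <= e / 3.
  rewrite /comb_eval -sumrB; under eq_bigr do rewrite -mulrBr.
  exact: (@comb_eval_norm _ (i N) (fun k => x (iter k phi w) - y (iter k phi w))).
have close_mean : `|orbit_mean phi m w x - orbit_mean phi m w y| <= e / 3.
  by rewrite /orbit_mean -(meanB hm)//; apply: (mean_norm hm) => k; exact: hx.
have combE N : comb_eval (i N) (fun k => y (iter k phi w)) = \sum_(j < n) a j * g (l j) (i N) w.
  rewrite /comb_eval; under eq_bigr do rewrite mulr_sumr.
  rewrite exchange_big/=; apply: eq_bigr => j _; rewrite /g /comb_eval mulr_sumr.
  by apply: eq_bigr => k _; rewrite mulrCA.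
have meanE : orbit_mean phi m w y = \sum_(j < n) a j * m (fun k => psi (l j) (iter k phi w)).
  rewrite /orbit_mean /y (mean_sum hm (f := fun (j : 'I_n) k => a j * psi (l j) (iter k phi w))).
    by apply: eq_bigr => j _; rewrite (meanZ hm).
  by move=> j; exact: bounded_seqZ.
have : comb_eval (i N) (fun k => y (iter k phi w)) @[N --> \oo] --> orbit_mean phi m w y.
  rewrite meanE; under eq_fun do rewrite combE.
  apply: (@cvg_sum_seq R n (fun j N => a j * g (l j) (i N) w)
    (fun j => a j * m (fun k => psi (l j) (iter k phi w)))) => j.
  by apply: cvgMr; rewrite -qm//; exact: hi.
move/cvgrPdist_le => /(_ _ e3); apply: filterS => N /=.
by move: (close_comb N) close_mean; rewrite !ler_norml; lra.
Qed.

End tame_systems.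

Lemma dual_dirac (R : realType) (T : pseudoPMetricType R) (w : T) : is_dual (@dirac_fun R T w).
Proof. by split => //; exists 1 => x b _ xb; rewrite mul1r; exact: xb. Qed.

Theorem theorem4p5 (R : realType) (T : pseudoPMetricType R) (phi : T -> T) :
  hausdorff_space T -> compact [set: T] -> continuous phi ->
  tame phi -> ergodically_decomposable phi.
Proof.
move=> _ cT cphi htame.
have [m hm extr] := exists_extreme_invariant_mean R.
have [i hi] := tame_mean_sequence cT cphi htame hm.
pose c n := (sval (i n)).2; pose N n := (sval (i n)).1.
have hc : convex_weights c N by move=> n; have := svalP (i n).
pose u (x : T -> R) n w := comb_eval (i n) (fun k => x (iter k phi w)).
have cxk (x : T -> R) : continuous x -> forall k, continuous (fun w => x (iter k phi w)).
  by move=> cx k; exact: continuous_orbit.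
have cu (x : T -> R) n : continuous x -> continuous (u x n).
  move=> cx; apply: (@cont_sum _ _ (N n) (fun k w => c n k * x (iter k phi w))) => k.
  by apply: cont_scale; exact: cxk.
have ub (x : T -> R) (b : R) n w : (forall v, `|x v| <= b) -> `|u x n w| <= b.
  by move=> xb; apply: comb_eval_norm => k; exact: xb.
have VE (x : T -> R) mu n : continuous x -> is_dual mu -> Vn_pair phi c N n x mu = mu (u x n).
  move=> cx hmu; rewrite /Vn_pair -(dual_sum (N n) (c n) hmu (x := fun k w => x (iter k phi w)))//.
  exact: cxk.
have cxphi (x : T -> R) : continuous x -> continuous (fun w => x (phi w)).
  by move=> cx; exact: (cxk x cx 1%N).
have Vcvg (x : T -> R) mu : continuous x -> is_dual mu -> cvg (Vn_pair phi c N n x mu @[n --> \oo]).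
  move=> cx hmu; have [b hb] := compact_bounded cT cx.
  under eq_fun do rewrite VE//.
  apply: (dual_cvg cT (F := fun w => orbit_mean phi m w x) (b := b) hmu).
  - by move=> n; exact: cu.
  - by move=> n w; exact: ub.
  - by move=> w; exact: hi.
pose Q (mu : (T -> R) -> R) (x : T -> R) : R := lim (Vn_pair phi c N n x mu @[n --> \oo]).
have QE (x : T -> R) mu : continuous x -> is_dual mu ->
    Vn_pair phi c N n x mu @[n --> \oo] --> Q mu x.
  by move=> cx hmu; exact: Vcvg.
exists c, N, Q; split; [|split; [|split; [|split]]] => //.
(* The averages of [x] and of its composition with [phi] converge at each point to the same orbit
   mean, so their bounded difference tends to 0 against [mu]. *)
- move=> x mu cx hmu; have [b hb] := compact_bounded cT cx.
  have E n : Vn_pair phi c N n x mu - Vn_pair phi c N n (fun w => x (phi w)) mu =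
      mu (fun w => u x n w - u (fun w => x (phi w)) n w).
    have cx' := cxphi x cx.
    by rewrite !VE// -dualB//; [exact: (cu x n cx)|exact: (cu _ n cx')].
  under eq_fun do rewrite E.
  apply: (dual_cvg0 cT (b := b + b) hmu).
  - by move=> n; apply: cont_sub; [exact: (cu x n cx)|exact: (cu _ n (cxphi x cx))].
  - move=> n w; rewrite (le_trans (ler_normB _ _))// lerD//; first exact: ub.
    by apply: ub => v; exact: hb.
  - move=> w; rewrite -(subrr (orbit_mean phi m w x)); apply: cvgB; first exact: hi.
    by rewrite -(orbit_mean_shift phi cT w hm cx); exact: (hi (fun v => x (phi v)) w (cxphi x cx)).
- move=> mu hmu; have [hlin [M hM]] := hmu; split.
    move=> a x y cx cy.
    have cxy : continuous (fun w => a * x w + y w) by apply: cont_add => //; exact: cont_scale.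
    apply/cvg_lim => //.
    have -> : (fun n => Vn_pair phi c N n (fun w => a * x w + y w) mu) =
        (fun n => a * Vn_pair phi c N n x mu + Vn_pair phi c N n y mu).
      apply/funext => n; rewrite /Vn_pair mulr_sumr -big_split; apply: eq_bigr => k _ /=.
      by rewrite hlin ?mulrDr 1?mulrCA//; exact: cxk.
    by apply: cvgD; [apply: cvgMr; exact: QE|exact: QE].
  exists M => x b cx xb; apply/ler_addgt0Pr => e e0.
  have /cvgrPdist_le/(_ e e0)[n _ /(_ n (leqnn n)) /=] := QE _ _ cx hmu.
  have : `|Vn_pair phi c N n x mu| <= M * b.
    by rewrite VE//; apply: hM; [exact: cu|move=> w; exact: ub].
  by rewrite !ler_norml; lra.
(* Against a Dirac functional the pairing is the average of [x] along the orbit of [w0], so its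
   limit is the orbit mean. *)
- move=> w0; apply: (@orbit_mean_ergodic R T phi cT cphi m w0 hm extr) => x cx.
  have hd := @dual_dirac R T w0.
  apply/cvg_lim => //; under eq_fun do rewrite VE//.
  exact: hi.
Qed.
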